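(* Let $\theta=(\eta,\Psi)\in\mathcal{M}_{LME}$, $\Psi=(\Psi_1,\dots,\Psi_K)$, and let $\xi_\theta=(\xi_\eta,\xi_\Psi)\in T_\theta\mathcal{M}_{LME}$ with $\xi_\Psi=(\xi_{\Psi_1},\dots,\xi_{\Psi_K})$. The Riemannian Hessian of the objective $$L_R(\theta)=(n-p)\,\eta+\log\det(H)+\log\det(X^TH^{-1}X)+\frac{y^TP(H)y}{\exp(\eta)}$$ is given by $$\operatorname{Hess}L_R(\theta)[\xi_\theta]=\begin{pmatrix}\zeta_\eta\\ \zeta_\Psi\end{pmatrix}\in T_\theta\mathcal{M}_{LME},\qquad \zeta_\Psi=(\zeta_{\Psi_1},\dots,\zeta_{\Psi_K}),$$ where $$\zeta_\eta=\frac{1}{\exp(\eta)}\bigg(\xi_\eta\,y^TP(H)y-\sum_{j=1}^Ky^T\Big(h_1\Big(\sum_{l_j=1}^{M_j}Z^{(j,l_j)}\xi_{\Psi_j}{Z^{(j,l_j)}}^T\Big)+h_2\Big(\sum_{l_j=1}^{M_j}Z^{(j,l_j)}\xi_{\Psi_j}{Z^{(j,l_j)}}^T\Big)\Big)y\bigg)$$ and, for $j=1,\dots,K$, $$\begin{aligned}\zeta_{\Psi_j}=\;&\Psi_j\bigg(\sum_{r=1}^K\sum_{l_j=1}^{M_j}{Z^{(j,l_j)}}^T\,\mathrm{D}_H\big(\operatorname{grad}^e_HL_R(\theta)\big)\Big[\sum_{l_r=1}^{M_r}Z^{(r,l_r)}\xi_{\Psi_r}{Z^{(r,l_r)}}^T\Big]Z^{(j,l_j)}\\&\qquad-\frac{\xi_\eta}{\exp(\eta)}\sum_{l_j=1}^{M_j}{Z^{(j,l_j)}}^T\operatorname{grad}^e_H\big(y^TP(H)y\big)Z^{(j,l_j)}\bigg)\Psi_j\\&+\frac12\bigg(\xi_{\Psi_j}\sum_{l_j=1}^{M_j}{Z^{(j,l_j)}}^T\operatorname{grad}^e_HL_R(\theta)Z^{(j,l_j)}\Psi_j+\Psi_j\sum_{l_j=1}^{M_j}{Z^{(j,l_j)}}^T\operatorname{grad}^e_HL_R(\theta)Z^{(j,l_j)}\xi_{\Psi_j}\bigg).\end{aligned}$$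 Here, for symmetric $\xi\in\mathbb{R}^{n\times n}$, $$\mathrm{D}_H\big(\operatorname{grad}^e_HL_R(\theta)\big)[\xi]=h_1(\xi)+h_2(\xi)+\frac{1}{\exp(\eta)}\big(h_3(\xi)-h_4(\xi)\big),$$ where $$\begin{aligned} h_1(\xi)&=-H^{-1}\xi H^{-1},\\ h_2(\xi)&=H^{-1}\xi H^{-1}X(X^TH^{-1}X)^{-1}X^TH^{-1}+H^{-1}X(X^TH^{-1}X)^{-1}X^TH^{-1}\xi H^{-1}\\&\quad-H^{-1}X(X^TH^{-1}X)^{-1}X^TH^{-1}\xi H^{-1}X(X^TH^{-1}X)^{-1}X^TH^{-1},\\ h_3(\xi)&=H^{-1}\xi H^{-1}yy^TH^{-1}+H^{-1}yy^TH^{-1}\xi H^{-1},\\ h_4(\xi)&=-\big(h_1(\xi)+h_2(\xi)\big)yy^TH^{-1}X(X^TH^{-1}X)^{-1}X^TH^{-1}+H^{-1}yy^Th_2(\xi)\\&\quad+\Big(-\big(h_1(\xi)+h_2(\xi)\big)yy^TH^{-1}X(X^TH^{-1}X)^{-1}X^TH^{-1}+H^{-1}yy^Th_2(\xi)\Big)^T, \end{aligned}$$ and $$\operatorname{grad}^e_HL_R(\theta)=P(H)+\frac{1}{\exp(\eta)}\operatorname{grad}^e_H\big(y^TP(H)y\big),$$ $$\operatorname{grad}^e_H\big(y^TP(H)y\big)=-H^{-1}yy^TH^{-1}+H^{-1}yv_1^TH^{-1}+H^{-1}v_1y^TH^{-1}-H^{-1}X(X^TH^{-1}X)^{-1}X^Tv_2v_2^TX(X^TH^{-1}X)^{-1}X^TH^{-1},$$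 with $v_1=X(X^TH^{-1}X)^{-1}X^TH^{-1}y$ and $v_2=H^{-1}y$.
   Context: Data: $n,p,K$ and $M_j,q_j$ ($j=1,\dots,K$) are positive integers; $X\in\mathbb{R}^{n\times p}$, $y\in\mathbb{R}^n$, and $Z^{(j,l_j)}\in\mathbb{R}^{n\times q_j}$ for $j=1,\dots,K$, $l_j=1,\dots,M_j$ are given. $X$ has full column rank, so that $X^TH^{-1}X$ is invertible for every symmetric positive definite $H$. Manifold: $\mathbb{P}^d$ is the set of real symmetric positive definite $d\times d$ matrices, an open subset of the space $\mathbb{S}^d$ of real symmetric $d\times d$ matrices, so its tangent space at each point is $\mathbb{S}^d$. Put $\mathcal{M}_{LME}=\mathbb{R}\times\mathbb{P}^{q_1}\times\dots\times\mathbb{P}^{q_K}$, with points $\theta=(\eta,\Psi)$, $\Psi=(\Psi_1,\dots,\Psi_K)$, and tangent space $T_\theta\mathcal{M}_{LME}=\mathbb{R}\times\mathbb{S}^{q_1}\times\dots\times\mathbb{S}^{q_K}$. The Riemannian metric is the product of the Euclidean metric on $\mathbb{R}$ and the affine-invariant metrics: $$\langle\xi,\chi\rangle_\theta=\xi_\eta\chi_\eta+\sum_{j=1}^K\operatorname{tr}\big(\Psi_j^{-1}\xi_{\Psi_j}\Psi_j^{-1}\chi_{\Psi_j}\big).$$ The Riemannian gradient $\operatorname{grad}f(\theta)$ of a smooth $f:\mathcal{M}_{LME}\to\mathbb{R}$ is the unique tangent vector with $\langle\operatorname{grad}f(\theta),\xi\rangle_\theta=\mathrm{D}f(\theta)[\xi]$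 for all $\xi\in T_\theta\mathcal{M}_{LME}$. The Riemannian Hessian is the linear operator on $T_\theta\mathcal{M}_{LME}$ defined by $\operatorname{Hess}f(\theta)[\xi_\theta]=\nabla_{\xi_\theta}\operatorname{grad}f(\theta)$, where $\nabla$ is the Riemannian (Levi-Civita) connection. For a single factor $\mathbb{P}^d$ with metric $\operatorname{tr}(\xi\Sigma^{-1}\chi\Sigma^{-1})$ it is known that $\operatorname{Hess}f(\Sigma)[\xi]=\mathrm{D}(\operatorname{grad}f)(\Sigma)[\xi]-\frac12\big(\xi\Sigma^{-1}\operatorname{grad}f(\Sigma)+\operatorname{grad}f(\Sigma)\Sigma^{-1}\xi\big)$, where $\mathrm{D}$ is the ordinary directional derivative; $\nabla$ on $\mathcal{M}_{LME}$ is the product connection. Functions: for $\theta\in\mathcal{M}_{LME}$, $$H=I_n+\sum_{j=1}^K\sum_{l_j=1}^{M_j}Z^{(j,l_j)}\Psi_j{Z^{(j,l_j)}}^T\in\mathbb{P}^n,\qquad P(H)=H^{-1}-H^{-1}X(X^TH^{-1}X)^{-1}X^TH^{-1}.$$ Euclidean derivatives with respect to $H$: the right-hand side defining $L_R$ (with $\eta$ fixed), and likewise $y^TP(H)y$, is regarded as a function of the matrix $H$, defined by the same formula on a neighbourhood of $\mathbb{P}^n$ in $\mathbb{R}^{n\times n}$. $\operatorname{grad}^e_H$ denotes its gradient with respect to the Euclidean inner product $\operatorname{tr}(A^TB)$ on $\mathbb{R}^{n\times n}$, evaluated at the symmetric positive definite matrix $H$. $\mathrm{D}_H(\operatorname{grad}^e_HL_R(\theta))[\xi]$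 denotes the directional derivative, at $H$ in the direction of the symmetric matrix $\xi\in\mathbb{R}^{n\times n}$, of the map sending a matrix in $\mathbb{P}^n$ to this gradient (with $\eta$ fixed). *)

(* Defs.v *)
From HB Require Import structures.
From mathcomp Require Import all_boot all_order all_algebra.
From mathcomp Require Import all_classical all_reals all_analysis.

Set Implicit Arguments.
Unset Strict Implicit.
Unset Printing Implicit Defensive.
Import Order.TTheory GRing.Theory Num.Theory.
Import numFieldNormedType.Exports.
Local Open Scope classical_set_scope.
Local Open Scope ring_scope.

(* Families (A_1, ..., A_K) of square matrices of sizes q_1, ..., q_K, with
   componentwise operations. *)
Definition blocks (R : realType) (K : nat) (q : 'I_K -> nat) : Type :=
  forall j : 'I_K, 'M[R]_(q j).

Section BlocksLmodule.
Variables (R : realType) (K : nat) (q : 'I_K -> nat).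
Local Notation T := (blocks R q).

HB.instance Definition _ := gen_eqMixin T.
HB.instance Definition _ := gen_choiceMixin T.

Definition blocks0 : T := fun j => 0.
Definition blocks_opp (A : T) : T := fun j => - A j.
Definition blocks_add (A B : T) : T := fun j => A j + B j.
Definition blocks_scale (a : R) (A : T) : T := fun j => a *: A j.

Fact blocks_addA : associative blocks_add.
Proof. by move=> A B C; apply: functional_extensionality_dep => j; exact: addrA. Qed.
Fact blocks_addC : commutative blocks_add.
Proof. by move=> A B; apply: functional_extensionality_dep => j; exact: addrC. Qed.
Fact blocks_add0 : left_id blocks0 blocks_add.
Proof. by move=> A; apply: functional_extensionality_dep => j; exact: add0r. Qed.
Fact blocks_addN : left_inverse blocks0 blocks_opp blocks_add.
Proof. by move=> A; apply: functional_extensionality_dep => j; exact: addNr. Qed.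

HB.instance Definition _ :=
  GRing.isZmodule.Build T blocks_addA blocks_addC blocks_add0 blocks_addN.

Fact blocks_scaleA a b A :
  blocks_scale a (blocks_scale b A) = blocks_scale (a * b) A.
Proof. by apply: functional_extensionality_dep => j; exact: scalerA. Qed.
Fact blocks_scale1 : left_id 1 blocks_scale.
Proof. by move=> A; apply: functional_extensionality_dep => j; exact: scale1r. Qed.
Fact blocks_scaleDr : right_distributive blocks_scale +%R.
Proof. by move=> a A B; apply: functional_extensionality_dep => j; exact: scalerDr. Qed.
Fact blocks_scaleDl A : {morph blocks_scale^~ A : a b / a + b}.
Proof. by move=> a b; apply: functional_extensionality_dep => j; exact: scalerDl. Qed.

HB.instance Definition _ := GRing.Zmodule_isLmodule.Build R T
  blocks_scaleA blocks_scale1 blocks_scaleDr blocks_scaleDl.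

End BlocksLmodule.

Definition symmetric_mx (R : realType) (d : nat) (A : 'M[R]_d) : Prop :=
  A^T = A.

Definition spd (R : realType) (d : nat) (A : 'M[R]_d) : Prop :=
  symmetric_mx A /\
  forall x : 'cV[R]_d, x != 0 -> 0 < (x^T *m A *m x) 0 0.

Section Geometry.
Variables (R : realType) (K : nat) (q : 'I_K -> nat).

(* Pairs (eta, Psi): both the points of the manifold and its tangent vectors
   live in this vector space. *)
Definition ambient : Type := (R * blocks R q)%type.
HB.instance Definition _ := GRing.Lmodule.on ambient.

Definition manifold : set ambient := [set theta | forall j, spd (theta.2 j)].

(* The manifold is open in the vector space of the pairs (xi_eta, xi_Psi) with
   all xi_Psi_j symmetric, which is its tangent space at every point. *)
Definition tangent : set ambient :=
  [set xi | forall j, symmetric_mx (xi.2 j)].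

Definition metric (theta xi chi : ambient) : R :=
  xi.1 * chi.1 +
  \sum_(j < K) \tr (invmx (theta.2 j) *m xi.2 j *m
                    invmx (theta.2 j) *m chi.2 j).

Definition Ddir (f : ambient -> R) (theta xi : ambient) : R :=
  derive1 (fun t : R => f (theta + t *: xi)) 0.

(* Frechet differentiability at theta of a function on an open subset of the
   finite-dimensional space of tangent vectors: differentiability of f
   restricted to every finite-dimensional affine chart
   t |-> theta + sum_i t_i xi_i with tangent directions xi_i (for a basis
   (xi_i) this is differentiability in the coordinates of that basis). *)
Definition frechet_at (f : ambient -> R) (theta : ambient) : Prop :=
  forall (m : nat) (xi : 'I_m -> ambient), (forall i, tangent (xi i)) ->
    differentiable
      (fun t : 'rV[R]_m => f (theta + \sum_(i < m) t 0 i *: xi i)) 0.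

Fixpoint ndifferentiable (k : nat) (f : ambient -> R) : Prop :=
  if k is k'.+1 then
    (forall theta, manifold theta -> frechet_at f theta) /\
    (forall xi, tangent xi ->
       ndifferentiable k' (fun theta => Ddir f theta xi))
  else True.

Definition smooth (f : ambient -> R) : Prop :=
  forall k, ndifferentiable k f.

(* Fields are total functions; only their values on the manifold matter. *)
Definition smooth_field (V : ambient -> ambient) : Prop :=
  [/\ forall theta, manifold theta -> tangent (V theta),
      smooth (fun theta => (V theta).1)
    & forall j (a b : 'I_(q j)), smooth (fun theta => (V theta).2 j a b)].

Definition Dfield (V : ambient -> ambient) (theta xi : ambient) : ambient :=
  (Ddir (fun th => (V th).1) theta xi,
   fun j => \matrix_(a, b) Ddir (fun th => (V th).2 j a b) theta xi).

Definition lie_bracket (U V : ambient -> ambient) (theta : ambient) : ambient :=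
  Dfield V theta (U theta) - Dfield U theta (V theta).

(* nabla V theta xi is the covariant derivative at theta of the field V in the
   direction xi. *)
Definition connection : Type :=
  (ambient -> ambient) -> ambient -> ambient -> ambient.

Record is_affine_connection (nabla : connection) : Prop := IsAffineConnection {
  nabla_smooth : forall U V, smooth_field U -> smooth_field V ->
    smooth_field (fun theta => nabla V theta (U theta)) ;
  nabla_linear_dir : forall V theta, smooth_field V -> manifold theta ->
    forall (a : R) xi chi, tangent xi -> tangent chi ->
    nabla V theta (a *: xi + chi) = a *: nabla V theta xi + nabla V theta chi ;
  nabla_linear : forall U V theta xi, smooth_field U -> smooth_field V ->
    manifold theta -> tangent xi -> forall a : R,
    nabla (fun th => a *: U th + V th) theta xi =
    a *: nabla U theta xi + nabla V theta xi ;
  nabla_leibniz : forall f V theta xi, smooth f -> smooth_field V ->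
    manifold theta -> tangent xi ->
    nabla (fun th => f th *: V th) theta xi =
    Ddir f theta xi *: V theta + f theta *: nabla V theta xi }.

Record is_levi_civita (nabla : connection) : Prop := IsLeviCivita {
  lc_affine : is_affine_connection nabla ;
  lc_torsion_free : forall U V theta, smooth_field U -> smooth_field V ->
    manifold theta ->
    nabla V theta (U theta) - nabla U theta (V theta) = lie_bracket U V theta ;
  lc_metric : forall U V theta xi, smooth_field U -> smooth_field V ->
    manifold theta -> tangent xi ->
    Ddir (fun th => metric th (U th) (V th)) theta xi =
    metric theta (nabla U theta xi) (V theta) +
    metric theta (U theta) (nabla V theta xi) }.

(* xget picks an element of the given set, here determined uniquely on smooth
   fields, points of the manifold and tangent directions. *)
Definition levi_civita : connection :=
  xget ((fun _ _ _ => 0) : connection) [set nabla | is_levi_civita nabla].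

Definition is_riemannian_grad (f : ambient -> R) (theta g : ambient) : Prop :=
  tangent g /\ forall xi, tangent xi -> metric theta g xi = Ddir f theta xi.

Definition riemannian_grad (f : ambient -> R) (theta : ambient) : ambient :=
  xget 0 [set g | is_riemannian_grad f theta g].

Definition riemannian_hess (f : ambient -> R) (theta xi : ambient) : ambient :=
  levi_civita (riemannian_grad f) theta xi.

End Geometry.

Definition is_euclidean_grad (R : realType) (n : nat) (f : 'M[R]_n -> R)
    (H G : 'M[R]_n) : Prop :=
  differentiable f H /\ forall V : 'M[R]_n, \tr (G^T *m V) = 'd f H V.

Definition euclidean_grad (R : realType) (n : nat) (f : 'M[R]_n -> R)
    (H : 'M[R]_n) : 'M[R]_n :=
  xget 0 [set G | is_euclidean_grad f H G].

Section Objective.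
Variables (R : realType) (n p K : nat) (M q : 'I_K -> nat).
Variables (X : 'M[R]_(n, p)) (y : 'cV[R]_n).
Variable Z : forall j : 'I_K, 'I_(M j) -> 'M[R]_(n, q j).

Definition Zsandwich (j : 'I_K) (A : 'M[R]_(q j)) : 'M[R]_n :=
  \sum_(l < M j) Z l *m A *m (Z l)^T.

Definition covH (Psi : blocks R q) : 'M[R]_n :=
  1%:M + \sum_(j < K) Zsandwich (Psi j).

Definition Pmx (H : 'M[R]_n) : 'M[R]_n :=
  invmx H - invmx H *m X *m invmx (X^T *m invmx H *m X) *m X^T *m invmx H.

Definition yPy (H : 'M[R]_n) : R := (y^T *m Pmx H *m y) 0 0.

(* The objective as a function of an arbitrary square matrix H, eta fixed. *)
Definition LRH (eta : R) (H : 'M[R]_n) : R :=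
  (n%:R - p%:R) * eta + ln (\det H) + ln (\det (X^T *m invmx H *m X)) +
  yPy H / expR eta.

Definition LR (theta : ambient R q) : R := LRH theta.1 (covH theta.2).

Definition h1 (H xi : 'M[R]_n) : 'M[R]_n := - (invmx H *m xi *m invmx H).

Definition h2 (H xi : 'M[R]_n) : 'M[R]_n :=
  let Hi := invmx H in let A := invmx (X^T *m Hi *m X) in
  Hi *m xi *m Hi *m X *m A *m X^T *m Hi
  + Hi *m X *m A *m X^T *m Hi *m xi *m Hi
  - Hi *m X *m A *m X^T *m Hi *m xi *m Hi *m X *m A *m X^T *m Hi.

Definition h3 (H xi : 'M[R]_n) : 'M[R]_n :=
  let Hi := invmx H in
  Hi *m xi *m Hi *m y *m y^T *m Hi + Hi *m y *m y^T *m Hi *m xi *m Hi.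

Definition h4 (H xi : 'M[R]_n) : 'M[R]_n :=
  let Hi := invmx H in let A := invmx (X^T *m Hi *m X) in
  let B := - ((h1 H xi + h2 H xi) *m y *m y^T *m Hi *m X *m A *m X^T *m Hi)
           + Hi *m y *m y^T *m h2 H xi in
  B + B^T.

End Objective.

(* Main.v *)
(* The affine-invariant connection
     nabla_xi V = DV[xi] - 1/2 (xi Psi^-1 V + V Psi^-1 xi)   (blockwise)
   is symmetric and metric.  The difference of two Levi-Civita connections is a
   tensor that is symmetric in its arguments and skew for the metric, hence
   zero, so nabla is the Levi-Civita connection.  Writing P = P(H), everything
   else follows from DP(H)[xi] = - P xi P = h_1(xi) + h_2(xi): the Euclidean
   gradient of y^T P y is - P y y^T P, that of L_R is P - exp(-eta) P y y^T P,
   the Riemannian gradient has blocks Psi_j (sum_l Z^T grad Z) Psi_j, and the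
   product rule gives the Hessian. *)
Require Import Defs.
From HB Require Import structures.
From mathcomp Require Import all_boot all_order all_algebra.
From mathcomp Require Import all_classical all_reals all_analysis.
From mathcomp Require Import ring lra.
Set Implicit Arguments.
Unset Strict Implicit.
Unset Printing Implicit Defensive.
Import Order.TTheory GRing.Theory Num.Theory.
Import numFieldNormedType.Exports.
Local Open Scope classical_set_scope.
Local Open Scope ring_scope.

(** * Derivatives of matrix-valued functions *)

(** [levi_civita], [riemannian_grad] and [euclidean_grad] are values of [xget], so each explicit
    formula must be paired with a uniqueness argument, and for the connection uniqueness is
    available on smooth fields only. Hence the gradient field has to be smooth to every order. This
    comes from closure of smooth functions under sums, products, reciprocals and [expR], with
    inverse matrices written as adjugate over determinant. The second obstacle is that [spd]
    includes symmetry: the manifold is open among tuples of symmetric matrices, in general not among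
    tuples of all square matrices. Derivatives on it are therefore taken in tangent directions,
    along which short lines and charts stay on the manifold, so that formulas valid only there can
    be differentiated. The Euclidean gradient in H, in contrast, tests nonsymmetric directions too;
    the derivative of P along a curve is therefore derived from positive definiteness at the base
    point alone. *)

Section FunAlgebra.
Variables (R : realType) (T : Type).

(** Differentiability at a point, [frechet_at] and [smooth] are the instances. Reciprocals are left
    out because they need a nonvanishing condition that differs between them. *)
Record fun_algebra (P : (T -> R) -> Prop) : Prop := FunAlgebra {
  fun_algebra_cst : forall c : R, P (fun=> c) ;
  fun_algebra_add : forall f g, P f -> P g -> P (fun x => f x + g x) ;
  fun_algebra_mul : forall f g, P f -> P g -> P (fun x => f x * g x) }.

Definition mx_all (P : (T -> R) -> Prop) m n (F : T -> 'M[R]_(m, n)) : Prop :=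
  forall i j, P (fun x => F x i j).

Variable P : (T -> R) -> Prop.
Hypothesis algP : fun_algebra P.

Lemma fun_algebra_ext (f g : T -> R) : f =1 g -> P g -> P f.
Proof. by move=> /funext ->. Qed.

Lemma fun_algebra_sum (I : Type) (r : seq I) (Q : pred I) (F : I -> T -> R) :
  (forall i, Q i -> P (F i)) -> P (fun x => \sum_(i <- r | Q i) F i x).
Proof.
move=> PF; elim: r => [|i r IHr].
  by apply: (fun_algebra_ext _ (fun_algebra_cst algP 0)) => x; rewrite big_nil.
apply: fun_algebra_ext => [x|]; first by rewrite big_cons.
by case Qi: (Q i) => //; apply: fun_algebra_add => //; exact: PF.
Qed.

Lemma fun_algebra_prod (I : Type) (r : seq I) (Q : pred I) (F : I -> T -> R) :
  (forall i, Q i -> P (F i)) -> P (fun x => \prod_(i <- r | Q i) F i x).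
Proof.
move=> PF; elim: r => [|i r IHr].
  by apply: (fun_algebra_ext _ (fun_algebra_cst algP 1)) => x; rewrite big_nil.
apply: fun_algebra_ext => [x|]; first by rewrite big_cons.
by case Qi: (Q i) => //; apply: fun_algebra_mul => //; exact: PF.
Qed.

Lemma mx_all_cst m n (A : 'M[R]_(m, n)) : mx_all P (fun=> A).
Proof. by move=> i j; exact: fun_algebra_cst. Qed.

Lemma mx_allD m n (F G : T -> 'M[R]_(m, n)) :
  mx_all P F -> mx_all P G -> mx_all P (fun x => F x + G x).
Proof.
move=> PF PG i j; apply: fun_algebra_ext => [x|]; first by rewrite mxE.
exact: fun_algebra_add.
Qed.

Lemma mx_allZ m n (c : T -> R) (F : T -> 'M[R]_(m, n)) :
  P c -> mx_all P F -> mx_all P (fun x => c x *: F x).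
Proof.
move=> Pc PF i j; apply: fun_algebra_ext => [x|]; first by rewrite mxE.
exact: fun_algebra_mul.
Qed.

Lemma mx_allN m n (F : T -> 'M[R]_(m, n)) :
  mx_all P F -> mx_all P (fun x => - F x).
Proof.
move=> PF i j; apply: fun_algebra_ext => [x|]; first by rewrite -scaleN1r.
by apply: (@mx_allZ _ _ (fun=> -1)) => //; exact: fun_algebra_cst.
Qed.

Lemma mx_allB m n (F G : T -> 'M[R]_(m, n)) :
  mx_all P F -> mx_all P G -> mx_all P (fun x => F x - G x).
Proof. by move=> PF PG; apply: mx_allD => //; exact: mx_allN. Qed.

Lemma mx_allT m n (F : T -> 'M[R]_(m, n)) :
  mx_all P F -> mx_all P (fun x => (F x)^T).
Proof.
move=> PF i j; apply: fun_algebra_ext => [x|]; first by rewrite mxE.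
exact: PF.
Qed.

Lemma mx_allM m n k (F : T -> 'M[R]_(m, n)) (G : T -> 'M[R]_(n, k)) :
  mx_all P F -> mx_all P G -> mx_all P (fun x => F x *m G x).
Proof.
move=> PF PG i j; apply: fun_algebra_ext => [x|]; first by rewrite mxE.
by apply: fun_algebra_sum => l _; exact: fun_algebra_mul.
Qed.

Lemma mx_all_sum m n (I : Type) (r : seq I) (Q : pred I)
    (F : I -> T -> 'M[R]_(m, n)) :
  (forall i, Q i -> mx_all P (F i)) ->
  mx_all P (fun x => \sum_(i <- r | Q i) F i x).
Proof.
move=> PF i j; apply: fun_algebra_ext => [x|]; first by rewrite summxE.
by apply: fun_algebra_sum => l /PF.
Qed.

(** By the Leibniz formula the determinant is a polynomial in the entries. *)
Lemma mx_all_det n (F : T -> 'M[R]_n) :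
  mx_all P F -> P (fun x => \det (F x)).
Proof.
move=> PF; apply: fun_algebra_sum => s _.
apply: fun_algebra_mul => //; first exact: fun_algebra_cst.
exact: fun_algebra_prod.
Qed.

Lemma mx_all_adj n (F : T -> 'M[R]_n) :
  mx_all P F -> mx_all P (fun x => \adj (F x)).
Proof.
move=> PF i j; apply: fun_algebra_ext => [x|]; first by rewrite mxE.
apply: fun_algebra_mul => //; first exact: fun_algebra_cst.
apply: mx_all_det => k l; apply: fun_algebra_ext => [x|]; first by rewrite !mxE.
exact: PF.
Qed.

End FunAlgebra.

(** * Differentiability of matrix entries and of the matrix inverse *)

Section Differentiability.
Variables (R : realType) (V : normedModType R).

(** The first-order expansion of f at x is also one of g, and [diff_unique] identifies its linear
    part with the differential of g. *)
Lemma near_eq_differentiable (W : normedModType R) (f g : V -> W) (x : V) :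
  {near x, f =1 g} -> differentiable f x -> differentiable g x.
Proof.
move=> fg df; have gx := nbhs_singleton fg.
have [dc dE] := (diff_locallyP _ _).1 df.
have gE : g \o shift x = cst (g x) + 'd f x +o_ 0 id.
  rewrite -gx; apply/eqaddoP => _/posnumP[e].
  move/eqaddoP: dE => /(_ e%:num (ltac:(by []))); apply: filter_app.
  have fg0 : \forall h \near 0, f (h + x) = g (h + x).
    by move: fg; rewrite (near_shift 0) subr0.
  by move: fg0; apply: filter_app; near=> h; rewrite !fctE/= => ->.
apply/diff_locallyP; rewrite (diff_unique dc gE); split => //.
Unshelve. all: by end_near. Qed.

Variable x : V.

Lemma differentiable_fun_algebra :
  fun_algebra (fun f : V -> R => differentiable f x).
Proof.
split=> [c|f g df dg|f g df dg]; first exact: differentiable_cst.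
- exact: differentiableD.
- exact: differentiableM.
Qed.

Lemma differentiable_mx_entries m n (F : V -> 'M[R]_(m, n)) :
  differentiable F x -> mx_all (fun f => differentiable f x) F.
Proof.
move=> dF i j.
exact: (@differentiable_comp R V _ _ F (fun M => M i j) x dF
          (differentiable_coord _ _ _)).
Qed.

(** The determinant stays nonzero near x, and there [invmx] is adjugate over determinant. The
    equality is only local, since [invmx] returns a singular matrix unchanged. *)
Lemma differentiable_entries_invmx n (F : V -> 'M[R]_n) :
  mx_all (fun f => differentiable f x) F -> F x \in unitmx ->
  mx_all (fun f => differentiable f x) (fun u => invmx (F u)).
Proof.
move=> dF; rewrite unitmxE unitfE => uF.
have ddet := mx_all_det differentiable_fun_algebra dF.
have dadj := mx_all_adj differentiable_fun_algebra dF.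
move=> i j; apply: (@near_eq_differentiable _
  (fun u => (\det (F u))^-1 * \adj (F u) i j)); last first.
  by apply: differentiableM => //; exact: differentiableV.
have nF : \forall u \near x, \det (F u) != 0.
  exact: cvgr_neq0 (differentiable_continuous ddet) uF.
near=> u; have uF' : \det (F u) != 0 by near: u.
by rewrite /invmx unitmxE unitfE uF' [RHS]mxE.
Unshelve. all: by end_near. Qed.

End Differentiability.

(** * Derivatives along lines and curves: products, inverse, determinant *)

Section Curves.
Variable R : realType.

(** Reduces directional derivatives on a matrix space to derivatives of functions of one real
    variable, for which the rules below are stated. *)
Lemma is_derive_lineP (V W : normedModType R) (f : V -> W) (x v : V) (d : W) :
  is_derive x v f d <->
  is_derive (0 : R) (1 : R) (fun h : R => f (h *: v + x)) d.
Proof.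
have E : 'D_v f x = 'D_1 (fun h : R => f (h *: v + x)) 0.
  rewrite /derive; set g1 := fun h => h^-1 *: _; set g2 := fun h => h^-1 *: _.
  suff -> : g1 = g2 by [].
  rewrite /g1 /g2; apply/funext => h /=.
  by rewrite addr0 scale0r add0r [_%:A]mulr1.
split=> -[df <-]; apply: DeriveDef => //; first exact: (derivable1P f x v).1.
exact: (derivable1P f x v).2.
Qed.

Lemma is_derive_mxP (V : normedModType R) m n (F : V -> 'M[R]_(m, n))
    (x v : V) (D : 'M[R]_(m, n)) :
  is_derive x v F D <->
  forall i j, is_derive x v (fun u => F u i j) (D i j).
Proof.
split=> [[dF <-] i j|dF].
  by split; [exact: (derivable_mxP _ _ _).1|rewrite derive_mx// mxE].
have dF' : derivable F x v by apply/derivable_mxP => i j; have [] := dF i j.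
split => //; rewrite derive_mx//; apply/matrixP => i j; rewrite mxE.
by have [] := dF i j.
Qed.

Lemma is_derive_sum_seq (V W : normedModType R) (I : Type) (r : seq I)
    (f : I -> V -> W) (x v : V) (d : I -> W) :
  (forall i, is_derive x v (f i) (d i)) ->
  is_derive x v (fun u => \sum_(i <- r) f i u) (\sum_(i <- r) d i).
Proof.
move=> df; elim: r => [|i r IHr].
  rewrite big_nil (_ : (fun _ => _) = cst 0); first exact: is_derive_cst.
  by apply/funext => u; rewrite big_nil.
rewrite big_cons; have -> : (fun u => \sum_(j <- i :: r) f j u) =
    f i + (fun u => \sum_(j <- r) f j u).
  by apply/funext => u; rewrite big_cons.
exact: is_deriveD.
Qed.

Lemma is_derive_mul (V : normedModType R) (f g : V -> R) (x v : V) (a b : R) :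
  is_derive x v f a -> is_derive x v g b ->
  is_derive x v (fun u => f u * g u) (a * g x + f x * b).
Proof.
move=> df dg; have /is_derive_eq := is_deriveM df dg; apply.
by rewrite addrC /GRing.scale/= [g x * a]mulrC.
Qed.

Lemma is_derive_mulmx (V : normedModType R) m n k (F : V -> 'M[R]_(m, n))
    (G : V -> 'M[R]_(n, k)) (x v : V) dF dG :
  is_derive x v F dF -> is_derive x v G dG ->
  is_derive x v (fun u => F u *m G u) (dF *m G x + F x *m dG).
Proof.
move=> /is_derive_mxP DF /is_derive_mxP DG; apply/is_derive_mxP => i j.
have -> : (fun u => (F u *m G u) i j) = (fun u => \sum_l F u i l * G u l j).
  by apply/funext => u; rewrite mxE.
rewrite !mxE -big_split/=; apply: is_derive_sum_seq => l; exact: is_derive_mul.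
Qed.

Lemma is_derive_mulmxl (V : normedModType R) m n k (A : 'M[R]_(m, n))
    (G : V -> 'M[R]_(n, k)) (x v : V) dG :
  is_derive x v G dG -> is_derive x v (fun u => A *m G u) (A *m dG).
Proof.
move=> DG; apply: (is_derive_eq (is_derive_mulmx (is_derive_cst A x v) DG)).
by rewrite mul0mx add0r.
Qed.

Lemma is_derive_mulmxr (V : normedModType R) m n k (F : V -> 'M[R]_(m, n))
    (B : 'M[R]_(n, k)) (x v : V) dF :
  is_derive x v F dF -> is_derive x v (fun u => F u *m B) (dF *m B).
Proof.
move=> DF; apply: (is_derive_eq (is_derive_mulmx DF (is_derive_cst B x v))).
by rewrite mulmx0 addr0.
Qed.

Lemma is_derive_mxtrace (V : normedModType R) n (F : V -> 'M[R]_n) (x v : V)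
    dF :
  is_derive x v F dF -> is_derive x v (fun u => \tr (F u)) (\tr dF).
Proof. by move=> /is_derive_mxP DF; exact: is_derive_sum_seq. Qed.

Lemma is_derive_scale (V : normedModType R) m n (f : V -> R)
    (F : V -> 'M[R]_(m, n)) (x v : V) df dF :
  is_derive x v f df -> is_derive x v F dF ->
  is_derive x v (fun u => f u *: F u) (df *: F x + f x *: dF).
Proof.
move=> Df /is_derive_mxP DF; apply/is_derive_mxP => i j.
have -> : (fun u => (f u *: F u) i j) = (fun u => f u * F u i j).
  by apply/funext => u; rewrite mxE.
by rewrite !mxE; exact: is_derive_mul.
Qed.

Lemma is_derive_affine m n (A B : 'M[R]_(m, n)) (t : R) :
  is_derive t (1 : R) (fun h : R => h *: B + A) B.
Proof.
have D := is_derive_scale (is_derive_id t (1 : R)) (is_derive_cst B t (1 : R)).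
apply: (is_derive_eq (is_deriveD D (is_derive_cst A t (1 : R)))).
by rewrite scale1r scaler0 !addr0.
Qed.

(** Differentiability comes from the adjugate formula; the value is then found by differentiating F
    F^-1 = 1, valid near t, and solving for the derivative of the inverse. *)
Lemma is_derive_invmx n (F : R -> 'M[R]_n) (t : R) (dF : 'M[R]_n) :
  F t \in unitmx -> is_derive t (1 : R) F dF ->
  is_derive t (1 : R) (fun u : R => invmx (F u))
    (- (invmx (F t) *m dF *m invmx (F t))).
Proof.
move=> uF DF; have dF1 : differentiable F t.
  by apply/derivable1_diffP; exact: ex_derive.
have dFe := differentiable_mx_entries dF1.
have DI : derivable (fun u => invmx (F u)) t 1.
  apply/derivable_mxP => i j; apply/derivable1_diffP.
  exact: (differentiable_entries_invmx dFe uF).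
split => //; set D := derive _ _ _.
have DD : is_derive t (1 : R) (fun u : R => invmx (F u)) D by split.
have D1 : dF *m invmx (F t) + F t *m D = 0.
  have [_ <-] := is_derive_mulmx DF DD.
  have /near_eq_derive -> : \near t, F t *m invmx (F t) = cst 1%:M t.
    have dF0 : \det (F t) != 0 by rewrite -unitfE -unitmxE.
    have ddet := mx_all_det (differentiable_fun_algebra t) dFe.
    have nF : \forall u \near t, \det (F u) != 0.
      exact: cvgr_neq0 (differentiable_continuous ddet) dF0.
    near=> u; have uF' : \det (F u) != 0 by near: u.
    by rewrite mulmxV// unitmxE unitfE.
  by rewrite derive_cst.
have : invmx (F t) *m (dF *m invmx (F t) + F t *m D) = 0 by rewrite D1 mulmx0.
rewrite mulmxDr !mulmxA mulVmx// mul1mx addrC => /eqP.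
by rewrite addr_eq0 => /eqP.
Unshelve. all: by end_near. Qed.

(** The cofactors of row i do not involve row i, so expansion along it shows that the determinant is
    affine in the entry (i, j), with the cofactor as slope. *)
Lemma derive_det_delta n (A : 'M[R]_n) i j :
  is_derive A (delta_mx i j) (fun M : 'M[R]_n => \det M) (cofactor A i j).
Proof.
apply/is_derive_lineP.
have E h : \det (h *: delta_mx i j + A) = h * cofactor A i j + \det A.
  rewrite (expand_det_row _ i) (expand_det_row A i).
  under eq_bigr => k _.
    rewrite !mxE (_ : cofactor _ i k = cofactor A i k); last first.
      rewrite /cofactor; congr (_ * \det _); apply/matrixP => a b.
      by rewrite !mxE eq_sym (negbTE (neq_lift _ _)) mulr0 add0r.
    rewrite mulrDl; over.
  rewrite big_split/=; congr (_ + _).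
  rewrite (bigD1 j)//= big1 ?addr0 ?eqxx ?mulr1// => k kj.
  by rewrite (negbTE kj) andbF mulr0 mul0r.
have -> := funext E.
have D1 : is_derive (0 : R) (1 : R) (fun h : R => h * cofactor A i j)
    (1 * cofactor A i j + 0 * 0).
  exact: (is_derive_mul (is_derive_id _ _) (is_derive_cst _ _ _)).
apply: (is_derive_eq (is_deriveD D1 (is_derive_cst (\det A) _ _))).
by rewrite mul1r mul0r !addr0.
Qed.

Lemma differentiable_det n (A : 'M[R]_n) :
  differentiable (fun M : 'M[R]_n => \det M) A.
Proof.
apply: (mx_all_det (differentiable_fun_algebra A)) => i j.
exact: differentiable_coord.
Qed.

(** Jacobi's formula, by linearity of the differential from its values on elementary matrices. *)
Lemma diff_det n (A B : 'M[R]_n) :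
  'd (fun M : 'M[R]_n => \det M) A B = \tr (\adj A *m B).
Proof.
rewrite {1}(matrix_sum_delta B) linear_sum/=.
rewrite /mxtrace; under [RHS]eq_bigr do rewrite mxE.
rewrite exchange_big/=; apply: eq_bigr => i _.
rewrite linear_sum/=; apply: eq_bigr => j _.
rewrite linearZ/= -deriveE; last exact: differentiable_det.
by have [_ ->] := derive_det_delta A i j; rewrite mxE mulrC.
Qed.

Lemma is_derive_lndet n (F : R -> 'M[R]_n) (t : R) (dF : 'M[R]_n) :
  0 < \det (F t) -> is_derive t (1 : R) F dF ->
  is_derive t (1 : R) (fun u : R => ln (\det (F u))) (\tr (invmx (F t) *m dF)).
Proof.
move=> det_gt0 DF; have dF1 : differentiable F t.
  by apply/derivable1_diffP; exact: ex_derive.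
have dd := @differentiable_det n (F t).
have D1 : is_derive t (1 : R) (fun u : R => \det (F u))
      (\tr (\adj (F t) *m dF)).
  have dc := differentiable_comp dF1 dd.
  split; first by apply/derivable1_diffP.
  rewrite deriveE// (diff_comp dF1 dd)/= -diff_det.
  by have [_ <-] := DF; rewrite [in RHS]deriveE.
have /is_derive_eq := is_derive1_comp (is_derive1_ln det_gt0) D1; apply.
by rewrite /invmx unitmxE unitfE gt_eqF// -scalemxAl linearZ.
Qed.

End Curves.

(** * Positive definite matrices *)

Section PositiveDefinite.
Variable R : realType.

Lemma spd_unitmx d (A : 'M[R]_d) : spd A -> A \in unitmx.
Proof.
move=> [_ posA]; rewrite -row_free_unit -kermx_eq0; apply: contraT.
move=> /rowV0Pn[u /sub_kermxP uA u0].
have := posA u^T; rewrite trmxK uA mul0mx mxE ltxx => /(_ _) //.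
by rewrite -(inj_eq trmx_inj) trmxK trmx0; apply.
Qed.

Lemma spd_congr n p (A : 'M[R]_n) (B : 'M[R]_(n, p)) :
  (forall x : 'cV_p, x != 0 -> B *m x != 0) -> spd A -> spd (B^T *m A *m B).
Proof.
move=> injB [symA posA]; split.
  by rewrite /symmetric_mx !trmx_mul trmxK symA mulmxA.
by move=> x /injB/posA; rewrite trmx_mul !mulmxA.
Qed.

(** The inverse of A is congruent to A, through the inverse itself. *)
Lemma spd_invmx d (A : 'M[R]_d) : spd A -> spd (invmx A).
Proof.
move=> spdA; have uA := spd_unitmx spdA.
have -> : invmx A = (invmx A)^T *m A *m invmx A.
  by rewrite -mulmxA mulmxV// mulmx1 trmx_inv spdA.1.
apply: spd_congr => // x; apply: contra_neq => /(congr1 (mulmx A)).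
by rewrite mulmxA mulmxV// mul1mx mulmx0.
Qed.

Lemma spd1 d : spd (1%:M : 'M[R]_d).
Proof.
split=> [|x x0]; first by rewrite /symmetric_mx trmx1.
rewrite mulmx1 mxE lt0r; apply/andP; split.
  apply: contra_neq x0 => /eqP.
  rewrite psumr_eq0 => [/allP x0|i _]; last by rewrite mxE -expr2 sqr_ge0.
  apply/matrixP => i j; rewrite ord1 mxE.
  by have := x0 i (mem_index_enum i); rewrite mxE -expr2 sqrf_eq0 => /eqP.
by apply: sumr_ge0 => i _; rewrite mxE -expr2 sqr_ge0.
Qed.

(** The summands of [covH] are only semidefinite, since a matrix [(Z l)^T] may have a kernel; the
    identity summand restores definiteness. *)
Definition psd d (A : 'M[R]_d) : Prop :=
  symmetric_mx A /\ forall x : 'cV[R]_d, 0 <= (x^T *m A *m x) 0 0.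

Lemma spd_psd d (A : 'M[R]_d) : spd A -> psd A.
Proof.
move=> [symA posA]; split => // x.
have [->|/posA/ltW//] := eqVneq x 0.
by rewrite mulmx0 mxE.
Qed.

Lemma psd_congr n d (A : 'M[R]_d) (B : 'M[R]_(n, d)) :
  psd A -> psd (B *m A *m B^T).
Proof.
move=> [symA posA]; split.
  by rewrite /symmetric_mx !trmx_mul trmxK symA mulmxA.
by move=> x; have := posA (B^T *m x); rewrite trmx_mul trmxK !mulmxA.
Qed.

Lemma psdD d (A B : 'M[R]_d) : psd A -> psd B -> psd (A + B).
Proof.
move=> [sA pA] [sB pB]; split; first by rewrite /symmetric_mx linearD/= sA sB.
by move=> x; rewrite mulmxDr mulmxDl mxE addr_ge0.
Qed.

Lemma psd_sum d (I : Type) (r : seq I) (F : I -> 'M[R]_d) :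
  (forall i, psd (F i)) -> psd (\sum_(i <- r) F i).
Proof.
move=> pF; elim/big_rec: _ => [|i A _ pA]; last exact: psdD.
by split=> [|x]; rewrite ?/symmetric_mx ?trmx0// mulmx0 mul0mx mxE.
Qed.

Lemma spd_add_psd d (A B : 'M[R]_d) : spd A -> psd B -> spd (A + B).
Proof.
move=> [sA pA] [sB pB]; split; first by rewrite /symmetric_mx linearD/= sA sB.
by move=> x /pA x0; rewrite mulmxDr mulmxDl mxE ltr_wpDr.
Qed.

Lemma spdZ d (a : R) (A : 'M[R]_d) : 0 < a -> spd A -> spd (a *: A).
Proof.
move=> a0 [sA pA]; split; first by rewrite /symmetric_mx linearZ/= sA.
by move=> x /pA x0; rewrite -scalemxAr -scalemxAl mxE mulr_gt0.
Qed.

(* The determinant does not vanish on the segment from the identity to A. *)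
Lemma spd_det_gt0 d (A : 'M[R]_d) : spd A -> 0 < \det A.
Proof.
move=> spdA; have uA := spd_unitmx spdA.
have detA0 : \det A != 0 by rewrite -unitfE -unitmxE.
rewrite lt_neqAle eq_sym detA0/= leNgt; apply/negP => detA_lt0.
pose f (t : R) := \det ((1 - t) *: 1%:M + t *: A).
have cf : {within `[0, 1], continuous f}.
  apply/continuous_subspaceT => t; apply: differentiable_continuous.
  have algt := differentiable_fun_algebra t.
  have did : differentiable (@id R) t by [].
  apply: (mx_all_det algt); apply: (mx_allD algt); apply: (mx_allZ algt) => //.
have f0 : f 0 = 1 by rewrite /f subr0 scale1r scale0r addr0 det1.
have f1 : f 1 = \det A by rewrite /f subrr scale1r scale0r add0r.
have [c] : exists2 c, c \in `[0, 1] & f c = 0.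
  apply: (IVT ler01 cf).
  by rewrite f0 f1 ge_min le_max ler01 (ltW detA_lt0) orbT.
rewrite in_itv/= => /andP[c0 c1] fc.
suff : spd ((1 - c) *: 1%:M + c *: A).
  by move=> /spd_unitmx; rewrite unitmxE -/(f c) fc unitr0.
move: c0; rewrite le_eqVlt => /predU1P[<-|c_gt0].
  by rewrite subr0 scale1r scale0r addr0; exact: spd1.
rewrite addrC; apply: spd_add_psd; first exact: spdZ.
move: c1; rewrite le_eqVlt => /predU1P[->|c_lt1].
  rewrite subrr scale0r; split=> [|x]; first by rewrite /symmetric_mx trmx0.
  by rewrite mulmx0 mul0mx mxE.
by apply/spd_psd/spdZ; [rewrite subr_gt0|exact: spd1].
Qed.

(* On the compact unit sphere of the sup norm the quadratic form of A is
   bounded below by some c > 0, and perturbing A by E changes it by at most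
   d ^ 2 * |E|. *)
Lemma spd_near d (A : 'M[R]_d) :
  spd A -> \forall B \near A, symmetric_mx B -> spd B.
Proof.
move=> [_ posA].
pose Q (B : 'M[R]_d) (u : 'rV[R]_d) : R := (u *m B *m u^T) 0 0.
pose S := [set u : 'rV[R]_d | `|u| = 1].
have QE B (u : 'rV[R]_d) : Q B u = \sum_i \sum_j u 0 i * B i j * u 0 j.
  rewrite /Q !mxE exchange_big/=; apply: eq_bigr => j _.
  by rewrite !mxE mulr_suml.
(* The extreme value theorem needs a nonempty sphere; if the sphere is empty there is no nonzero
   vector to test. *)
have [S0|S0] := pselect (S !=set0); last first.
  near=> B => sB; split => // x x0; exfalso; apply: S0.
  have xT0 : x^T != 0 by rewrite -(inj_eq trmx_inj) trmxK trmx0.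
  exists (`|x^T|^-1 *: x^T); rewrite /S/= normrZ normfV normr_id mulVf//.
  by rewrite normr_eq0.
have cS : compact S.
  apply: bounded_closed_compact.
    exists 1; split; first exact: num_real.
    by move=> y y1 u /= ->; exact: ltW.
  rewrite (_ : S = Num.norm @^-1` [set 1]); last by [].
  apply: closed_comp; last exact: closed_eq.
  by move=> u _; exact: norm_continuous.
have cQ : {within S, continuous (Q A)}.
  apply/continuous_subspaceT => u; apply: differentiable_continuous.
  have algu := differentiable_fun_algebra u.
  have du : mx_all (fun f => differentiable f u) (@idfun 'rV[R]_d).
    by move=> i j; exact: differentiable_coord.
  exact: (mx_allM algu (mx_allM algu du (mx_all_cst algu A)) (mx_allT du) 0 0).
have [u0 /set_mem u0S minQ] := EVT_min_rV S0 cS cQ.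
have c0 : 0 < Q A u0.
  have := posA u0^T; rewrite trmxK; apply.
  apply/eqP => /(congr1 trmx); rewrite trmxK trmx0 => u00.
  by move: u0S; rewrite /S/= u00 normr0 => /eqP; rewrite eq_sym oner_eq0.
(* Only d ^ 2 times the distance has to stay below the minimum; the + 1 makes the denominator
   positive without a case distinction on d. *)
have e0 : 0 < Q A u0 / (d%:R ^+ 2 + 1) by rewrite divr_gt0// ltr_wpDl ?sqr_ge0.
near=> B => sB; split => // x x0.
have xT0 : `|x^T| != 0 by rewrite normr_eq0 -(inj_eq trmx_inj) trmxK trmx0.
pose u := `|x^T|^-1 *: x^T.
have uS : S u by rewrite /S/= /u normrZ normfV normr_id mulVf.
have entry_le m n (M : 'M[R]_(m, n)) i j : `|M i j| <= `|M|.
  by rewrite [leRHS]/Num.Def.normr/= mx_normrE; exact: (le_bigmax _ _ (i, j)).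
have AB : `|A - B| < Q A u0 / (d%:R ^+ 2 + 1).
  by near: B; exact: cvgr_dist_lt.
have QB : 0 < Q B u.
  have : Q A u - Q B u < Q A u0.
    apply: (@le_lt_trans _ _ (d%:R ^+ 2 * `|A - B|)); last first.
      move: AB; rewrite ltr_pdivlMr ?ltr_wpDl ?sqr_ge0// => AB.
      apply: le_lt_trans AB; rewrite mulrC ler_wpM2l// lerDl//.
    have -> : Q A u - Q B u = Q (A - B) u.
      by rewrite /Q mulmxBr mulmxBl !mxE.
    rewrite QE (le_trans (ler_norm _))// (le_trans (ler_norm_sum _ _ _))//.
    have -> : d%:R ^+ 2 * `|A - B| = \sum_(i < d) \sum_(j < d) `|A - B|.
      by rewrite !sumr_const card_ord -mulrnA mulnn -natrX mulr_natl.
    apply: ler_sum => i _; rewrite (le_trans (ler_norm_sum _ _ _))//.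
    apply: ler_sum => j _; rewrite !normrM.
    have ui k : `|u 0 k| <= 1 by rewrite -uS.
    rewrite -[leRHS]mulr1 -[X in _ <= X * _]mul1r.
    by rewrite ler_pM ?mulr_ge0 ?ler_pM.
  by have := minQ u (mem_set uS); lra.
have -> : x = `|x^T| *: u^T.
  by rewrite /u linearZ/= trmxK scalerA mulfV// scale1r.
rewrite [(_ *: _)^T]linearZ/= trmxK -scalemxAr -2!scalemxAl 2!mxE.
have xT_gt0 : 0 < `|x^T| by rewrite lt_def xT0/=.
by do 2 apply: mulr_gt0 => //.
Unshelve. all: by end_near. Qed.

End PositiveDefinite.

(** * Smooth functions on the manifold *)

Section Smoothness.
Variables (R : realType) (K : nat) (q : 'I_K -> nat).
Local Notation amb := (ambient R q).
Implicit Types (f g : amb -> R) (theta xi chi : amb).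

Lemma ambient_eq (u v : amb) :
  u.1 = v.1 -> (forall j, u.2 j = v.2 j) -> u = v.
Proof.
case: u v => [u1 u2] [v1 v2] /= -> uv; congr pair.
exact: functional_extensionality_dep.
Qed.

Lemma sum_ambient1 (I : Type) (r : seq I) (F : I -> amb) :
  (\sum_(i <- r) F i).1 = \sum_(i <- r) (F i).1.
Proof. exact: (big_morph (fun u : amb => u.1)). Qed.

Lemma sum_ambient2 (I : Type) (r : seq I) (F : I -> amb) j :
  (\sum_(i <- r) F i).2 j = \sum_(i <- r) (F i).2 j.
Proof. exact: (big_morph (fun u : amb => u.2 j)). Qed.

Lemma tangentD xi chi : tangent xi -> tangent chi -> tangent (xi + chi).
Proof.
by move=> tx tc j; rewrite /symmetric_mx [LHS]linearD/= (tx j) (tc j).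
Qed.

Lemma tangentZ (a : R) xi : tangent xi -> tangent (a *: xi).
Proof. by move=> tx j; rewrite /symmetric_mx [LHS]linearZ/= (tx j). Qed.

Lemma tangentN xi : tangent xi -> tangent (- xi).
Proof. by move=> tx j; rewrite /symmetric_mx [LHS]linearN/= (tx j). Qed.

Lemma tangent0 : tangent (0 : amb).
Proof. by move=> j; exact: trmx0. Qed.

Lemma tangent_sum (I : Type) (r : seq I) (F : I -> amb) :
  (forall i, tangent (F i)) -> tangent (\sum_(i <- r) F i).
Proof.
move=> tF; elim/big_rec: _ => [|i u _ tu]; first exact: tangent0.
exact: tangentD.
Qed.

(** Openness holds only among symmetric matrices, hence the assumption that [c] stays tangent. The
    finitely many blocks are handled by intersecting neighbourhoods. The parameter space is left
    general to cover both lines and charts. *)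
Lemma manifold_near (V : normedModType R) (c : V -> amb) (x : V) :
  (forall j, differentiable (fun u => (c u).2 j) x) ->
  (forall u, tangent (c u)) -> manifold (c x) ->
  \forall u \near x, manifold (c u).
Proof.
move=> dc tc mx.
have : \forall u \near x, forall j, spd ((c u).2 j).
  apply: filter_forall => j.
  have H : \forall u \near x, symmetric_mx ((c u).2 j) -> spd ((c u).2 j).
    exact: (differentiable_continuous (dc j) (spd_near (mx j))).
  by apply: filterS H => u; apply; exact: (tc u j).
by [].
Qed.

Lemma manifold_near_line theta xi : manifold theta -> tangent xi ->
  \forall t \near (0 : R), manifold (theta + t *: xi).
Proof.
move=> mt tx; apply: manifold_near => [j|t|].
- have d1 := @differentiable_cst R R _ (theta.2 j) (0 : R).
  have d2 : differentiable (fun t : R => t *: xi.2 j) 0.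
    exact: differentiableZl.
  exact: (differentiableD d1 d2).
- by apply: tangentD; [move=> j; case: (mt j)|exact: tangentZ].
- by rewrite scale0r addr0.
Qed.

Lemma manifold_near_chart m theta (xi : 'I_m -> amb) :
  manifold theta -> (forall i, tangent (xi i)) ->
  \forall t \near (0 : 'rV[R]_m),
    manifold (theta + \sum_(i < m) (t : 'rV[R]_m) 0 i *: xi i).
Proof.
move=> mt tx; apply: manifold_near => [j|t|].
- have d1 := @differentiable_cst R 'rV[R]_m _ (theta.2 j) 0.
  have d2 : differentiable
      (\sum_(i < m) (fun t : 'rV[R]_m => t 0 i *: (xi i).2 j)) 0.
    apply: differentiable_sum => i.
    exact/differentiableZl/differentiable_coord.
  have -> : (fun t : 'rV[R]_m => (theta + \sum_(i < m) t 0 i *: xi i).2 j) =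
      cst (theta.2 j) + \sum_(i < m) (fun t : 'rV[R]_m => t 0 i *: (xi i).2 j).
    apply/funext => t.
    transitivity (theta.2 j + (\sum_(i < m) t 0 i *: xi i).2 j); first by [].
    rewrite sum_ambient2 fct_sumE; by [].
  exact: (differentiableD d1 d2).
- apply: tangentD; first by move=> j; case: (mt j).
  by apply: tangent_sum => i; exact: tangentZ.
- by rewrite big1 ?addr0// => i _; rewrite mxE scale0r.
Qed.

Lemma frechet_at_ext f g theta : manifold theta ->
  (forall th, manifold th -> f th = g th) ->
  frechet_at f theta -> frechet_at g theta.
Proof.
move=> mt fg df m xi tx; apply: near_eq_differentiable (df m xi tx).
near=> t; apply: fg; near: t; exact: manifold_near_chart.
Unshelve. all: by end_near. Qed.

Lemma Ddir_ext f g theta xi : manifold theta -> tangent xi ->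
  (forall th, manifold th -> f th = g th) -> Ddir f theta xi = Ddir g theta xi.
Proof.
move=> mt tx fg; rewrite /Ddir !derive1E; apply: near_eq_derive.
near=> t; apply: fg; near: t; exact: manifold_near_line.
Unshelve. all: by end_near. Qed.

Lemma frechet_fun_algebra theta : fun_algebra (fun f => frechet_at f theta).
Proof.
split=> [c m xi tx|f g df dg m xi tx|f g df dg m xi tx].
- exact: differentiable_cst.
- by apply: differentiableD; [exact: df|exact: dg].
- by apply: differentiableM; [exact: df|exact: dg].
Qed.

(** Expresses derivatives in all directions spanned by the [xi i] as values of one linear map, the
    differential of the chart. *)
Lemma frechet_is_derive_chart f theta m (xi : 'I_m -> amb) (c : 'rV[R]_m) :
  frechet_at f theta -> (forall i, tangent (xi i)) ->
  is_derive (0 : R) (1 : R)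
    (fun t : R => f (theta + t *: \sum_(i < m) c 0 i *: xi i))
    ('d (fun t : 'rV[R]_m => f (theta + \sum_(i < m) t 0 i *: xi i)) 0 c).
Proof.
move=> df tx; have dg := df m xi tx.
set g := fun t : 'rV[R]_m => _ in dg *.
rewrite (_ : (fun t : R => _) = (fun t : R => g (t *: c + 0))); last first.
  apply/funext => t; rewrite /g scaler_sumr addr0; congr (f (_ + _)).
  by apply: eq_bigr => i _; rewrite mxE scalerA.
apply: (is_derive_lineP g 0 c _).1.
apply: DeriveDef; first exact: diff_derivable.
exact: deriveE.
Qed.

Lemma frechet_is_derive f theta xi : frechet_at f theta -> tangent xi ->
  is_derive (0 : R) (1 : R) (fun t : R => f (theta + t *: xi))
    (Ddir f theta xi).
Proof.
move=> df tx.
have [dd _] :=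
  @frechet_is_derive_chart f theta 1 (fun=> xi) (const_mx 1) df (fun=> tx).
have E : \sum_(i < 1) (const_mx 1 : 'rV[R]_1) 0 i *: xi = xi.
  by rewrite big_ord1 mxE scale1r.
rewrite E in dd; apply: (DeriveDef dd).
by rewrite /Ddir derive1E.
Qed.

(** Linearity is that of the differential of the two-parameter chart with directions [xi] and
    [chi]. *)
Lemma Ddir_linear f theta (a : R) xi chi : frechet_at f theta ->
  tangent xi -> tangent chi ->
  Ddir f theta (a *: xi + chi) = a * Ddir f theta xi + Ddir f theta chi.
Proof.
move=> df tx tc.
pose v (i : 'I_2) := if i == 0 then xi else chi.
have tv i : tangent (v i) by rewrite /v; case: ifP.
pose e b c : 'rV[R]_2 := \row_i (if i == 0 then b else c).
have De b c : Ddir f theta (b *: xi + c *: chi) =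
    'd (fun t : 'rV[R]_2 => f (theta + \sum_(i < 2) t 0 i *: v i)) 0 (e b c).
  have [_ <-] := frechet_is_derive_chart (e b c) df tv.
  by rewrite /Ddir derive1E !big_ord_recl big_ord0 !mxE/= addr0.
rewrite -[chi in LHS]scale1r De.
rewrite (_ : e a 1 = a *: e 1 0 + e 0 1); last first.
  apply/rowP => i; rewrite !mxE; case: ifP => _; first by rewrite mulr1 addr0.
  by rewrite mulr0 add0r.
rewrite linearP/= -!De !scale0r !scale1r addr0 add0r.
by [].
Qed.

Lemma Ddir0 f theta : Ddir f theta 0 = 0.
Proof.
rewrite /Ddir (_ : (fun _ => _) = cst (f theta)) ?derive1_cst//.
by apply/funext => t; rewrite scaler0 addr0.
Qed.

Lemma Ddir_sum f theta (I : Type) (r : seq I) (c : I -> R) (e : I -> amb) :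
  frechet_at f theta -> (forall i, tangent (e i)) ->
  Ddir f theta (\sum_(i <- r) c i *: e i) =
  \sum_(i <- r) c i * Ddir f theta (e i).
Proof.
move=> df te; elim: r => [|i r IHr]; first by rewrite !big_nil Ddir0.
rewrite !big_cons Ddir_linear// ?IHr//.
by apply: tangent_sum => k; exact: tangentZ.
Qed.

Lemma is_derive_Ddir f theta xi (d : R) :
  is_derive (0 : R) (1 : R) (fun t : R => f (theta + t *: xi)) d ->
  Ddir f theta xi = d.
Proof. by case=> _ <-; rewrite /Ddir derive1E. Qed.

Lemma DdirD f g theta xi : frechet_at f theta -> frechet_at g theta ->
  tangent xi ->
  Ddir (fun th => f th + g th) theta xi = Ddir f theta xi + Ddir g theta xi.
Proof.
move=> df dg tx; apply: is_derive_Ddir.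
exact: (is_deriveD (frechet_is_derive df tx) (frechet_is_derive dg tx)).
Qed.

Lemma DdirM f g theta xi : frechet_at f theta -> frechet_at g theta ->
  tangent xi ->
  Ddir (fun th => f th * g th) theta xi =
  Ddir f theta xi * g theta + f theta * Ddir g theta xi.
Proof.
move=> df dg tx; apply: is_derive_Ddir.
have := is_derive_mul (frechet_is_derive df tx) (frechet_is_derive dg tx).
by rewrite scale0r addr0.
Qed.

Lemma Ddir_comp f (h : R -> R) (d : R) theta xi :
  frechet_at f theta -> tangent xi -> is_derive (f theta) (1 : R) h d ->
  Ddir (fun th => h (f th)) theta xi = d * Ddir f theta xi.
Proof.
move=> df tx dh; apply: is_derive_Ddir.
apply: (is_derive1_comp _ (frechet_is_derive df tx)).
by rewrite scale0r addr0.
Qed.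

Lemma frechet_comp f (h : R -> R) theta :
  frechet_at f theta -> differentiable h (f theta) ->
  frechet_at (fun th => h (f th)) theta.
Proof.
move=> df dh m xi tx; have dg := df m xi tx.
apply: (differentiable_comp dg).
by rewrite big1 ?addr0// => i _; rewrite mxE scale0r.
Qed.

(** * Differentiability of higher order and smooth functions *)

Lemma ndifferentiable_ext k f g :
  (forall th, manifold th -> f th = g th) ->
  ndifferentiable k f -> ndifferentiable k g.
Proof.
elim: k f g => // k IHk f g fg [df Df]; split=> [th mt|xi tx].
  exact: frechet_at_ext fg (df th mt).
by apply: IHk (Df xi tx) => th mt; exact: Ddir_ext.
Qed.

Lemma smooth_ext f g :
  (forall th, manifold th -> f th = g th) -> smooth f -> smooth g.
Proof. by move=> fg sf k; exact: ndifferentiable_ext (sf k). Qed.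

Lemma ndifferentiableW k f : ndifferentiable k.+1 f -> ndifferentiable k f.
Proof.
elim: k f => // k IHk f [df Df]; split=> // xi tx.
exact: IHk (Df xi tx).
Qed.

Lemma ndifferentiable_cst k (c : R) : ndifferentiable k (fun _ : amb => c).
Proof.
elim: k c => // k IHk c; split=> [th mt|xi tx].
  exact: fun_algebra_cst (frechet_fun_algebra _) _.
by apply: ndifferentiable_ext (IHk 0) => th mt; rewrite /Ddir derive1_cst.
Qed.

Lemma ndifferentiableD k f g : ndifferentiable k f -> ndifferentiable k g ->
  ndifferentiable k (fun th => f th + g th).
Proof.
elim: k f g => // k IHk f g [df Df] [dg Dg]; split=> [th mt|xi tx].
  by apply: fun_algebra_add (frechet_fun_algebra _) _ _ _ _; auto.
apply: ndifferentiable_ext (IHk _ _ (Df xi tx) (Dg xi tx)) => th mt.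
by rewrite DdirD//; auto.
Qed.

(** The product rule keeps one factor undifferentiated in each term; [ndifferentiableW] lowers its
    order so that the induction hypothesis applies. *)
Lemma ndifferentiableM k f g : ndifferentiable k f -> ndifferentiable k g ->
  ndifferentiable k (fun th => f th * g th).
Proof.
elim: k f g => // k IHk f g nf ng; have [df Df] := nf; have [dg Dg] := ng.
split=> [th mt|xi tx].
  by apply: fun_algebra_mul (frechet_fun_algebra _) _ _ _ _; auto.
apply: (@ndifferentiable_ext _
  (fun th => Ddir f th xi * g th + f th * Ddir g th xi)) => [th mt|].
  by rewrite DdirM//; auto.
apply: ndifferentiableD; first exact: IHk (Df xi tx) (ndifferentiableW ng).
exact: IHk (ndifferentiableW nf) (Dg xi tx).
Qed.

Lemma smooth_fun_algebra : fun_algebra (@smooth R K q).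
Proof.
split=> [c k|f g sf sg k|f g sf sg k].
- exact: ndifferentiable_cst.
- exact: ndifferentiableD.
- exact: ndifferentiableM.
Qed.

Lemma smooth_frechet f theta : smooth f -> manifold theta -> frechet_at f theta.
Proof. by move=> /(_ 1)[+ _]; apply. Qed.

Lemma smooth_Ddir f xi :
  smooth f -> tangent xi -> smooth (fun th => Ddir f th xi).
Proof. by move=> sf tx k; have [_] := sf k.+1; apply. Qed.

(** Induction on the order: the derivative of 1/f is -(1/f)^2 times that of f, where 1/f is needed
    only to the previous order. *)
Lemma smoothV f : (forall th, manifold th -> f th != 0) ->
  smooth f -> smooth (fun th => (f th)^-1).
Proof.
move=> f0 sf; elim=> // k IHk; split=> [th mt|xi tx].
  apply: (@frechet_comp f GRing.inv); first exact: smooth_frechet.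
  by apply: differentiable_Rinv; exact: f0.
have nI2 := ndifferentiableM IHk IHk.
apply: (@ndifferentiable_ext _
  (fun th => -1 * (((f th)^-1 * (f th)^-1) * Ddir f th xi))) => [th mt|].
  have df0 := @differentiable_Rinv R (f th) (f0 th mt).
  have dI : is_derive (f th) (1 : R) GRing.inv (- (f th) ^- 2).
    apply: DeriveDef; first exact: diff_derivable.
    rewrite deriveE// diff_Rinv; [exact: mulr1|exact: f0].
  rewrite (Ddir_comp (smooth_frechet sf mt) tx dI).
  by rewrite mulN1r mulNr -exprVn expr2.
apply: ndifferentiableM; first exact: ndifferentiable_cst.
by apply: ndifferentiableM => //; exact: smooth_Ddir.
Qed.

Lemma smooth_expR f : smooth f -> smooth (fun th => expR (f th)).
Proof.
move=> sf; elim=> // k IHk; split=> [th mt|xi tx].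
  apply: (@frechet_comp f expR); first exact: smooth_frechet.
  exact/derivable1_diffP/derivable_expR.
apply: (@ndifferentiable_ext _ (fun th => expR (f th) * Ddir f th xi)).
  move=> th mt.
  by rewrite (Ddir_comp (smooth_frechet sf mt) tx (is_derive_expR (f th))).
by apply: ndifferentiableM => //; exact: smooth_Ddir.
Qed.

(** The first derivative in direction [xi] is the constant [l xi]. Algebraic linearity suffices
    because differentiability is tested on finite-dimensional charts. *)
Lemma smooth_linear (l : amb -> R) :
  (forall (a : R) u v, l (a *: u + v) = a * l u + l v) -> smooth l.
Proof.
move=> ll.
have l0 : l 0 = 0.
  have := ll 1 0 0; rewrite scaler0 addr0 mul1r => /eqP.
  by rewrite -subr_eq0 opprD addNKr oppr_eq0 => /eqP.
have lD u v : l (u + v) = l u + l v by rewrite -[u]scale1r ll mul1r scale1r.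
have lS (I : Type) (r : seq I) (c : I -> R) (F : I -> amb) :
    l (\sum_(i <- r) c i *: F i) = \sum_(i <- r) c i * l (F i).
  elim: r => [|i r IHr]; first by rewrite !big_nil.
  by rewrite !big_cons ll IHr.
case=> // k; split=> [th mt m xi tx|xi tx].
  rewrite (_ : (fun _ => _) =
      (fun t : 'rV[R]_m => l th + \sum_(i < m) t 0 i * l (xi i))); last first.
    by apply/funext => t; rewrite lD lS.
  have alg0 := @differentiable_fun_algebra R 'rV[R]_m 0.
  apply: (fun_algebra_add alg0); first exact: (fun_algebra_cst alg0).
  apply: (fun_algebra_sum alg0) => i _; apply: (fun_algebra_mul alg0).
    exact: differentiable_coord.
  exact: (fun_algebra_cst alg0).
apply: ndifferentiable_ext (ndifferentiable_cst k (l xi)) => th mt.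
apply/esym/is_derive_Ddir.
rewrite (_ : (fun _ => _) = (fun t : R => t * l xi) + cst (l th)); last first.
  by apply/funext => t; rewrite addrC ll.
have D1 : is_derive (0 : R) (1 : R) (fun t : R => t * l xi) (1 * l xi + 0 * 0).
  exact: (is_derive_mul (is_derive_id _ _) (is_derive_cst _ _ _)).
apply: (is_derive_eq (is_deriveD D1 (is_derive_cst (l th) _ _))).
by rewrite mul1r mulr0 !addr0.
Qed.

Lemma smooth_fst : smooth (fun th : amb => th.1).
Proof. exact: smooth_linear. Qed.

Lemma mx_all_smooth_snd j : mx_all (@smooth R K q) (fun th : amb => th.2 j).
Proof. by move=> a b; apply: smooth_linear => c u v; rewrite !mxE. Qed.

Lemma mx_all_smooth_ext m n (F G : amb -> 'M[R]_(m, n)) :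
  (forall th, manifold th -> F th = G th) ->
  mx_all (@smooth R K q) F -> mx_all (@smooth R K q) G.
Proof. by move=> FG sF i j; apply: smooth_ext (sF i j) => th /FG ->. Qed.

Lemma mx_all_smooth_invmx n (F : amb -> 'M[R]_n) :
  (forall th, manifold th -> F th \in unitmx) ->
  mx_all (@smooth R K q) F -> mx_all (@smooth R K q) (fun th => invmx (F th)).
Proof.
move=> uF sF.
apply: (@mx_all_smooth_ext _ _ (fun th => (\det (F th))^-1 *: \adj (F th))).
  by move=> th /uF uth; rewrite /invmx uth.
apply: (mx_allZ smooth_fun_algebra);
  last exact: (mx_all_adj smooth_fun_algebra sF).
apply: smoothV; last exact: (mx_all_det smooth_fun_algebra sF).
by move=> th /uF; rewrite unitmxE unitfE.
Qed.

(** The symmetrised elementary matrix (E_ab + E_ba)/2 placed in block j. Indices are compared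
    through [val] because those of block k and of block j have different types. *)
Definition sym_delta j (a b : 'I_(q j)) : amb :=
  (0, fun k => \matrix_(c, d)
        (2^-1 * ([&& k == j, val c == val a & val d == val b]%:R +
                 [&& k == j, val c == val b & val d == val a]%:R))).

Lemma tangent_sym_delta j (a b : 'I_(q j)) : tangent (sym_delta a b).
Proof.
move=> k; apply/matrixP => c d; rewrite !mxE; congr (_ * _).
by rewrite addrC; congr (_%:R + _%:R); rewrite !(andbC (val c == _)).
Qed.

Lemma sum_delta_entry m n (A : 'M[R]_(m, n)) (c : 'I_m) (d : 'I_n) :
  \sum_a \sum_b A a b * ((val c == val a) && (val d == val b))%:R = A c d.
Proof.
rewrite (bigD1 c)//= [X in _ + X]big1 ?addr0 => [|a ac]; last first.
  rewrite big1// => b _.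
  by rewrite (inj_eq val_inj) eq_sym (negbTE ac) mulr0.
rewrite (bigD1 d)//= big1 ?addr0 => [|b bd]; first by rewrite !eqxx mulr1.
by rewrite eqxx/= (inj_eq val_inj) eq_sym (negbTE bd) mulr0.
Qed.

(** Summing x_ab (E_ab + E_ba)/2 over all a and b gives (x + x^T)/2, which is x for symmetric x. *)
Lemma tangent_decomp xi : tangent xi ->
  xi = xi.1 *: ((1, 0) : amb) +
       \sum_j \sum_a \sum_b xi.2 j a b *: sym_delta a b.
Proof.
move=> tx; apply: ambient_eq.
  rewrite /= sum_ambient1 big1 ?addr0 ?[RHS]mulr1// => j _.
  rewrite sum_ambient1 big1// => a _; rewrite sum_ambient1 big1// => b _.
  by rewrite /= [LHS]mulr0.
move=> k; apply/matrixP => c d; set S := \sum_j _.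
transitivity (S.2 k c d); last by rewrite /= scaler0 add0r.
have SE j : (\sum_a \sum_b xi.2 j a b *: sym_delta a b).2 k c d =
    \sum_a \sum_b xi.2 j a b *
      (2^-1 * ([&& k == j, val c == val a & val d == val b]%:R +
               [&& k == j, val c == val b & val d == val a]%:R)).
  rewrite sum_ambient2 summxE; apply: eq_bigr => a _.
  rewrite sum_ambient2 summxE; apply: eq_bigr => b _.
  by rewrite !mxE.
rewrite /S sum_ambient2 summxE (bigD1 k)//.
rewrite [X in _ = _ _ X]big1 ?addr0 => [|j jk]; last first.
  rewrite SE big1// => a _; rewrite big1// => b _.
  by rewrite eq_sym (negbTE jk) addr0 !mulr0.
rewrite SE eqxx/= addr0.
transitivity (2^-1 * (\sum_a \sum_b xi.2 k a b *
    ((val c == val a) && (val d == val b))%:R +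
    \sum_a \sum_b xi.2 k a b *
    ((val d == val a) && (val c == val b))%:R)).
  have E : xi.2 k d c = xi.2 k c d by rewrite -[in LHS](tx k) mxE.
  by rewrite !sum_delta_entry E; field.
rewrite -[in LHS]big_split [LHS]mulr_sumr/=; apply: eq_bigr => a _.
rewrite -[in LHS]big_split [LHS]mulr_sumr/=; apply: eq_bigr => b _.
by rewrite [(val d == val a) && _]andbC /=; ring.
Qed.

(** Smoothness speaks of derivatives in constant directions only. Expanding U over the fixed vectors
    of [tangent_decomp] turns the derivative along U into a sum of products of smooth functions. *)
Lemma smooth_Ddir_field f (U : amb -> amb) :
  smooth f -> smooth_field U -> smooth (fun th => Ddir f th (U th)).
Proof.
move=> sf [tU sU1 sU2].
have t10 : tangent ((1, 0) : amb) by move=> j; exact: trmx0.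
apply: (@smooth_ext (fun th => (U th).1 * Ddir f th (1, 0) +
  \sum_j \sum_a \sum_b (U th).2 j a b * Ddir f th (sym_delta a b))).
  move=> th mt; have df := smooth_frechet sf mt.
  rewrite [in RHS](tangent_decomp (tU th mt)) Ddir_linear//; last first.
    apply: tangent_sum => j; apply: tangent_sum => a; apply: tangent_sum => b.
    exact/tangentZ/tangent_sym_delta.
  congr (_ + _).
  have tsum j a : tangent (\sum_b (U th).2 j a b *: sym_delta a b).
    by apply: tangent_sum => b; exact/tangentZ/tangent_sym_delta.
  (* The coefficients 1 give the outer sums the shape of a linear combination, as [Ddir_sum]
     expects. *)
  rewrite [RHS](_ : _ = Ddir f th (\sum_j 1 *: \sum_a 1 *:
    \sum_b (U th).2 j a b *: sym_delta a b)); last first.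
    congr (Ddir _ _ _); apply: eq_bigr => j _; rewrite scale1r.
    by apply: eq_bigr => a _; rewrite scale1r.
  rewrite Ddir_sum//; last first.
    by move=> j; apply: tangent_sum => a; exact: tangentZ.
  apply: eq_bigr => j _; rewrite mul1r Ddir_sum//.
  apply: eq_bigr => a _; rewrite mul1r Ddir_sum// => b.
  exact: tangent_sym_delta.
have algS := smooth_fun_algebra.
apply: (fun_algebra_add algS).
  by apply: (fun_algebra_mul algS) => //; exact: smooth_Ddir.
do 3 apply: (fun_algebra_sum algS) => ? _.
apply: (fun_algebra_mul algS) => //; apply: smooth_Ddir => //.
exact: tangent_sym_delta.
Qed.

End Smoothness.

(** * The Levi-Civita connection *)

Section MatrixEntries.
Variables (R : realType) (m n : nat).
Implicit Types (A B : 'M[R]_(m, n)).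

Lemma addmxE A B i j : (A + B) i j = A i j + B i j. Proof. exact: mxE. Qed.
Lemma oppmxE A i j : (- A) i j = - A i j. Proof. exact: mxE. Qed.
Lemma scalemxE (a : R) A i j : (a *: A) i j = a * A i j. Proof. exact: mxE. Qed.

End MatrixEntries.

(** Normal form of a noncommutative polynomial: products distributed and associated to the left,
    signs and scalars pulled out. *)
Ltac mx_expand :=
  rewrite ?(mulmxDl, mulmxDr, mulNmx, mulmxN, opprD, opprK, =^~ scalemxAl,
            =^~ scalemxAr, mulmxA).

(* [ring] requires a commutative ring: sums of noncommutative products are
   compared entry by entry, with the entries of the products as atoms. *)
Ltac mx_linear :=
  let i := fresh "i" in let j := fresh "j" in
  apply/matrixP => i j; rewrite ?(addmxE, oppmxE, scalemxE).

Lemma mxtraceN (R : realType) n (A : 'M[R]_n) : \tr (- A) = - \tr A.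
Proof. exact: linearN. Qed.

Section Connection.
Variables (R : realType) (K : nat) (q : 'I_K -> nat).
Local Notation amb := (ambient R q).
Implicit Types (U V W : amb -> amb) (theta xi chi : amb).

Lemma is_derive_field1 V theta xi :
  smooth_field V -> manifold theta -> tangent xi ->
  is_derive (0 : R) (1 : R) (fun t : R => (V (theta + t *: xi)).1)
    (Dfield V theta xi).1.
Proof.
move=> [_ sV _] mt tx.
exact: (frechet_is_derive (smooth_frechet sV mt) tx).
Qed.

Lemma is_derive_field2 V theta xi j :
  smooth_field V -> manifold theta -> tangent xi ->
  is_derive (0 : R) (1 : R) (fun t : R => (V (theta + t *: xi)).2 j)
    ((Dfield V theta xi).2 j).
Proof.
move=> [_ _ sV] mt tx; apply/is_derive_mxP => a b; rewrite mxE.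
exact: (frechet_is_derive (smooth_frechet (sV j a b) mt) tx).
Qed.

Lemma DfieldE V theta xi (d : amb) :
  is_derive (0 : R) (1 : R) (fun t : R => (V (theta + t *: xi)).1) d.1 ->
  (forall j, is_derive (0 : R) (1 : R)
     (fun t : R => (V (theta + t *: xi)).2 j) (d.2 j)) ->
  Dfield V theta xi = d.
Proof.
move=> d1 d2; apply: ambient_eq => [|j]; first exact: is_derive_Ddir d1.
apply/matrixP => a b; rewrite mxE.
by apply: is_derive_Ddir; have /is_derive_mxP := d2 j; exact.
Qed.

Lemma Dfield_ext U V theta xi : manifold theta -> tangent xi ->
  (forall th, manifold th -> U th = V th) ->
  Dfield U theta xi = Dfield V theta xi.
Proof.
move=> mt tx UV; apply: ambient_eq => [|j] /=.
  by apply: Ddir_ext => // th /UV ->.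
by apply/matrixP => a b; rewrite !mxE; apply: Ddir_ext => // th /UV ->.
Qed.

Lemma tangent_Dfield V theta xi : smooth_field V -> manifold theta ->
  tangent xi -> tangent (Dfield V theta xi).
Proof.
move=> [tV _ _] mt tx j; apply/matrixP => a b; rewrite !mxE.
by apply: Ddir_ext => // th /tV /(_ j) tj; rewrite -[in LHS]tj mxE.
Qed.

Lemma smooth_field_cst xi : tangent xi -> smooth_field (fun=> xi).
Proof.
move=> tx; split=> // [|j a b];
  exact: (fun_algebra_cst (smooth_fun_algebra R q)).
Qed.

(** The zeroth-order part of the connection; it vanishes on the factor R, whose metric is flat. *)
Definition christoffel theta xi chi : amb :=
  (0, fun j => - (2^-1 *: (xi.2 j *m invmx (theta.2 j) *m chi.2 j +
                           chi.2 j *m invmx (theta.2 j) *m xi.2 j))).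

Definition affine_invariant_connection : connection R q :=
  fun V theta xi => Dfield V theta xi + christoffel theta xi (V theta).

Local Notation nabla := affine_invariant_connection.

Lemma christoffelC theta xi chi :
  christoffel theta xi chi = christoffel theta chi xi.
Proof. by apply: ambient_eq => // j; rewrite /= addrC. Qed.

Lemma tangent_christoffel theta xi chi : manifold theta -> tangent xi ->
  tangent chi -> tangent (christoffel theta xi chi).
Proof.
move=> mt tx tc j; rewrite /symmetric_mx /= linearN linearZ linearD/=.
rewrite !trmx_mul trmx_inv (mt j).1 (tx j) (tc j) addrC.
by rewrite !mulmxA.
Qed.

Lemma nabla_smooth_field U V : smooth_field U -> smooth_field V ->
  smooth_field (fun th => nabla V th (U th)).
Proof.
move=> sU sV; have [tU sU1 sU2] := sU; have [tV sV1 sV2] := sV.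
have algS := smooth_fun_algebra R q.
split=> [th mt||j].
- by apply: tangentD; [exact: tangent_Dfield (tU _ _)|
     exact: tangent_christoffel (tU _ _) (tV _ _)].
- apply: (fun_algebra_add algS); last exact: (fun_algebra_cst algS).
  exact: smooth_Ddir_field.
have sI := mx_all_smooth_invmx (fun th mt => spd_unitmx (mt j))
  (@mx_all_smooth_snd R K q j).
apply: (mx_allD algS).
  move=> a b; apply: smooth_ext (smooth_Ddir_field (sV2 j a b) sU) => th mt.
  by rewrite mxE.
apply: (mx_allN algS); apply: (mx_allZ algS (fun_algebra_cst algS _)).
apply: (mx_allD algS); apply: (mx_allM algS); do ?apply: (mx_allM algS);
  by [exact: sI|exact: sU2|exact: sV2].
Qed.

Lemma metricDl theta xi chi w :
  metric theta (xi + chi) w = metric theta xi w + metric theta chi w.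
Proof.
rewrite /metric mulrDl addrACA; congr (_ + _); rewrite -big_split/=.
by apply: eq_bigr => j _; rewrite mulmxDr !mulmxDl linearD.
Qed.

Lemma metricNl theta xi w : metric theta (- xi) w = - metric theta xi w.
Proof.
rewrite /metric mulNr opprD; congr (_ + _); rewrite -sumrN.
by apply: eq_bigr => j _; rewrite mulmxN !mulNmx linearN.
Qed.

Lemma metricBl theta xi chi w :
  metric theta (xi - chi) w = metric theta xi w - metric theta chi w.
Proof. by rewrite metricDl metricNl. Qed.

Lemma metricC theta xi chi : metric theta xi chi = metric theta chi xi.
Proof.
rewrite /metric mulrC; congr (_ + _); apply: eq_bigr => j _.
by rewrite -mulmxA mxtrace_mulC mulmxA.
Qed.

(* Testing against Psi_j D_j Psi_j gives the squared Frobenius norm of D. *)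
Lemma metric_nondegenerate theta (D : amb) : manifold theta -> tangent D ->
  (forall w, tangent w -> metric theta D w = 0) -> D = 0.
Proof.
move=> mt tD D0.
pose w : amb := (D.1, fun j => theta.2 j *m D.2 j *m theta.2 j).
have tw : tangent w.
  by move=> j; rewrite /symmetric_mx /= !trmx_mul (mt j).1 (tD j) mulmxA.
have trDD j : \tr (invmx (theta.2 j) *m D.2 j *m invmx (theta.2 j) *m w.2 j) =
    \sum_a \sum_b D.2 j a b ^+ 2.
  have uj := spd_unitmx (mt j).
  rewrite /w /= !mulmxA mulmxKV// mxtrace_mulC !mulmxA mulmxV// mul1mx.
  apply: eq_bigr => a _; rewrite mxE; apply: eq_bigr => b _.
  by rewrite -{2}(tD j) mxE expr2.
have s0 j : 0 <= \sum_a \sum_b D.2 j a b ^+ 2.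
  by apply: sumr_ge0 => a _; apply: sumr_ge0 => b _; exact: sqr_ge0.
move/eqP: (D0 w tw); rewrite /metric.
under eq_bigr do rewrite trDD.
rewrite paddr_eq0 ?sumr_ge0 ?sqr_ge0 -?expr2 ?sqr_ge0// => /andP[].
rewrite sqrf_eq0 => /eqP D1 /eqP /psumr_eq0P-/(_ (fun j _ => s0 j)) D2.
apply: ambient_eq => // j; apply/matrixP => a b; rewrite [RHS]mxE; apply/eqP.
rewrite -sqrf_eq0; apply/eqP.
have /psumr_eq0P D2j := D2 j isT.
have /psumr_eq0P D2ja :=
  D2j (fun a _ => sumr_ge0 _ (fun b _ => sqr_ge0 _)) a isT.
by apply: D2ja => // c _; exact: sqr_ge0.
Qed.

(** Here P stands for the inverse of Psi_j, whose derivative along x is - P x P. The traces of P x P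
    u P v and P u P x P v produced by the product rule are each split in halves between the two
    corrections; one cyclic rotation matches them. *)
Lemma metric_trace_identity d (P x u v du dv : 'M[R]_d) :
  \tr (((- (P *m x *m P) *m u + P *m du) *m P + P *m u *m - (P *m x *m P)) *m v
       + P *m u *m P *m dv) =
  \tr (P *m (du - 2^-1 *: (x *m P *m u + u *m P *m x)) *m P *m v) +
  \tr (P *m u *m P *m (dv - 2^-1 *: (x *m P *m v + v *m P *m x))).
Proof.
mx_expand; rewrite ?scalerDr; mx_expand.
rewrite ?(mxtraceD, mxtraceZ, mxtraceN).
have -> : \tr (P *m u *m P *m v *m P *m x) = \tr (P *m x *m P *m u *m P *m v).
  by rewrite -mulmxA mxtrace_mulC !mulmxA.
by field.
Qed.

Lemma Ddir_metric U V theta xi : smooth_field U -> smooth_field V ->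
  manifold theta -> tangent xi ->
  Ddir (fun th => metric th (U th) (V th)) theta xi =
  metric theta (nabla U theta xi) (V theta) +
  metric theta (U theta) (nabla V theta xi).
Proof.
move=> sU sV mt tx; apply: is_derive_Ddir.
have e0 : theta + 0 *: xi = theta by rewrite scale0r addr0.
have dP j : is_derive (0 : R) (1 : R)
    (fun t : R => invmx ((theta + t *: xi).2 j))
    (- (invmx (theta.2 j) *m xi.2 j *m invmx (theta.2 j))).
  have d1 : is_derive (0 : R) (1 : R) (fun t : R => (theta + t *: xi).2 j)
      (xi.2 j).
    rewrite (_ : (fun _ => _) = (fun t : R => t *: xi.2 j + theta.2 j)).
      exact: is_derive_affine.
    by apply/funext => t; exact: addrC.
  have := @is_derive_invmx R _ (fun t : R => (theta + t *: xi).2 j) 0 (xi.2 j).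
  by rewrite e0; apply => //; exact: spd_unitmx.
have dU1 := is_derive_field1 sU mt tx; have dV1 := is_derive_field1 sV mt tx.
have dU2 j := is_derive_field2 j sU mt tx.
have dV2 j := is_derive_field2 j sV mt tx.
have dt j := is_derive_mxtrace (is_derive_mulmx (is_derive_mulmx
  (is_derive_mulmx (dP j) (dU2 j)) (dP j)) (dV2 j)).
have dS := is_derive_sum_seq (index_enum 'I_K) dt.
apply: (is_derive_eq (is_deriveD (is_derive_mul dU1 dV1) dS)).
rewrite e0 /metric /= !addr0 [RHS]addrACA; congr (_ + _).
rewrite -big_split/=; apply: eq_bigr => j _; exact: metric_trace_identity.
Qed.

Lemma affine_invariant_is_affine : is_affine_connection nabla.
Proof.
split.
- exact: nabla_smooth_field.
- move=> V theta sV mt a xi chi tx tc.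
  rewrite /nabla scalerDr addrACA; congr (_ + _).
    have [_ sV1 sV2] := sV; apply: ambient_eq => [|j] /=.
      by apply: Ddir_linear => //; exact: smooth_frechet.
    apply/matrixP => b c; rewrite !mxE.
    by apply: Ddir_linear => //; exact: (smooth_frechet (sV2 j b c)).
  apply: ambient_eq => [|j] /=; first by rewrite scaler0 addr0.
  by mx_expand; mx_linear; ring.
- move=> U V theta xi sU sV mt tx a.
  rewrite /nabla scalerDr addrACA; congr (_ + _).
    have ca := is_derive_cst a (0 : R) (1 : R).
    apply: DfieldE => [|j].
      have := is_deriveD (is_derive_mul ca (is_derive_field1 sU mt tx))
        (is_derive_field1 sV mt tx).
      by move/is_derive_eq; apply; rewrite mul0r add0r.
    have := is_deriveD (is_derive_scale ca (is_derive_field2 j sU mt tx))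
        (is_derive_field2 j sV mt tx).
    by move/is_derive_eq; apply; rewrite scale0r add0r.
  apply: ambient_eq => [|j] /=; first by rewrite scaler0 addr0.
  by mx_expand; mx_linear; ring.
- move=> f V theta xi sf sV mt tx.
  have df := frechet_is_derive (smooth_frechet sf mt) tx.
  have e0 : theta + 0 *: xi = theta by rewrite scale0r addr0.
  rewrite /nabla scalerDr addrA; congr (_ + _).
    apply: DfieldE => [|j].
      have := is_derive_mul df (is_derive_field1 sV mt tx).
      by rewrite e0.
    have := is_derive_scale df (is_derive_field2 j sV mt tx).
    by rewrite e0.
  apply: ambient_eq => [|j] /=; first by rewrite scaler0.
  by mx_expand; mx_linear; ring.
Qed.

Lemma affine_invariant_is_levi_civita : is_levi_civita nabla.
Proof.
split; first exact: affine_invariant_is_affine.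
- move=> U V theta sU sV mt; rewrite /nabla [in X in _ - X]christoffelC.
  by rewrite opprD addrACA subrr addr0.
- exact: Ddir_metric.
Qed.

(* The difference T of two Levi-Civita connections is symmetric in its two
   field arguments and skew for the metric, which forces <T(U,V),W> to equal
   its opposite. *)
Lemma levi_civita_unique (nabla1 nabla2 : connection R q) :
  is_levi_civita nabla1 -> is_levi_civita nabla2 ->
  forall V theta xi, smooth_field V -> manifold theta -> tangent xi ->
  nabla1 V theta xi = nabla2 V theta xi.
Proof.
move=> lc1 lc2 V theta xi sV mt tx.
pose T U V := nabla1 V theta (U theta) - nabla2 V theta (U theta).
have symT A B : smooth_field A -> smooth_field B -> T A B = T B A.
  move=> sA sB; rewrite /T.
  have t1 := lc_torsion_free lc1 sA sB mt.
  have t2 := lc_torsion_free lc2 sA sB mt.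
  rewrite -t2 in t1; have /eqP := t1; rewrite subr_eq => /eqP ->.
  by rewrite addrC addrA addKr addrC.
have skewT A B C : smooth_field A -> smooth_field B -> smooth_field C ->
    metric theta (T A B) (C theta) = - metric theta (B theta) (T A C).
  move=> sA sB sC; have tA : tangent (A theta) by case: sA => tA _ _; exact: tA.
  have m1 := lc_metric lc1 sB sC mt tA; have m2 := lc_metric lc2 sB sC mt tA.
  rewrite /T metricBl [in RHS]metricC metricBl ![metric _ _ (B theta)]metricC.
  by rewrite m1 in m2; lra.
(* All tangent spaces coincide, so a tangent vector at [theta] extends to a constant field. *)
have sx := smooth_field_cst tx.
suff : T (fun=> xi) V = 0 by move/eqP; rewrite subr_eq0 => /eqP.
apply: (metric_nondegenerate mt).
  have [t1 _ _] := nabla_smooth (lc_affine lc1) sx sV.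
  have [t2 _ _] := nabla_smooth (lc_affine lc2) sx sV.
  by apply: tangentD; [exact: t1|apply: tangentN; exact: t2].
move=> w tw; have sw := smooth_field_cst tw.
set X : amb -> amb := fun=> xi; set W : amb -> amb := fun=> w.
(* With a = <T(X,V),W>, b = <T(X,W),V> and c = <T(V,W),X>, symmetry turns the three instances into a
   = -b, b = -c and c = -a, hence a = 0. *)
have e1 := skewT X V W sx sV sw; have e2 := skewT W X V sw sx sV.
have e3 := skewT V W X sV sw sx.
rewrite (symT V X)// (symT V W)// in e3; rewrite (symT W X)// in e2.
rewrite [in RHS]metricC in e1; rewrite [in RHS]metricC in e2.
rewrite [in RHS]metricC in e3.
rewrite /W /X /= in e1 e2 e3 *; lra.
Qed.

(** Existence of one Levi-Civita connection makes the choice of [xget] a Levi-Civita connection, and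
    uniqueness then fixes its value. *)
Lemma levi_civitaE V theta xi : smooth_field V -> manifold theta ->
  tangent xi -> @levi_civita R K q V theta xi = nabla V theta xi.
Proof.
move=> sV mt tx; apply: levi_civita_unique => //.
  by apply: (@xgetPex _ _ [set nb | is_levi_civita nb]);
    exists nabla; exact: affine_invariant_is_levi_civita.
exact: affine_invariant_is_levi_civita.
Qed.

Lemma riemannian_gradE (f : amb -> R) theta g :
  manifold theta -> is_riemannian_grad f theta g -> riemannian_grad f theta = g.
Proof.
move=> mt [tg gE]; have : is_riemannian_grad f theta (riemannian_grad f theta).
  by apply: (@xgetPex _ _ [set h | is_riemannian_grad f theta h]); exists g.
move=> [tr rE]; apply/eqP; rewrite -subr_eq0; apply/eqP.
apply: (metric_nondegenerate mt).
  by apply: tangentD => //; exact: tangentN.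
by move=> w tw; rewrite metricBl rE// gE// subrr.
Qed.

End Connection.

(** * Derivatives of the projection P(H) *)

Section ProjectionCalculus.
Variables (R : realType) (n p : nat) (X : 'M[R]_(n, p)) (y : 'cV[R]_n).
Hypothesis rankX : \rank X = p.

Local Notation P := (Pmx X).
Local Notation info H := (X^T *m invmx H *m X).

(** The term subtracted from H^-1 in P(H), named so that it can serve as an atom in the identities
    for h_3 and h_4. *)
Definition hatC (H : 'M[R]_n) : 'M[R]_n :=
  invmx H *m X *m invmx (info H) *m X^T *m invmx H.

Lemma PmxE H : P H = invmx H - hatC H. Proof. by []. Qed.

Lemma h1Dh2 H chi : h1 H chi + h2 X H chi = - (P H *m chi *m P H).
Proof. by rewrite /h1 /h2 /Pmx/=; mx_expand; mx_linear; ring. Qed.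

(** Full column rank makes x -> X x injective, so this is a congruence of H^-1. *)
Lemma spd_info H : spd H -> spd (info H).
Proof.
move=> /spd_invmx; apply: spd_congr => x; apply: contra_neq => Xx.
have freeX : row_free X^T by rewrite /row_free mxrank_tr rankX.
apply: trmx_inj; rewrite trmx0; apply/eqP.
by rewrite -(mulmx_free_eq0 _ freeX) -trmx_mul Xx trmx0.
Qed.

Lemma invmx_sym d (H : 'M[R]_d) : spd H -> (invmx H)^T = invmx H.
Proof. by move=> /spd_invmx[]. Qed.

Lemma hatC_sym H : spd H -> (hatC H)^T = hatC H.
Proof.
move=> sH; rewrite /hatC !trmx_mul (invmx_sym sH) (invmx_sym (spd_info sH)).
by rewrite trmxK !mulmxA.
Qed.

Lemma Pmx_sym H : spd H -> (P H)^T = P H.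
Proof. by move=> sH; rewrite PmxE linearB/= invmx_sym// hatC_sym. Qed.

(** From h_1 + h_2 = - N and h_1 = - H^-1 chi H^-1 follows h_2 = H^-1 chi H^-1 - N, which eliminates
    h_1 and h_2. *)
Lemma h4E H chi :
  let N := P H *m chi *m P H in let Hi := invmx H in
  let B := N *m (y *m y^T) *m hatC H
           + Hi *m (y *m y^T) *m (Hi *m chi *m Hi - N) in
  h4 X y H chi = B + B^T.
Proof.
have h2E : h2 X H chi =
    invmx H *m chi *m invmx H - P H *m chi *m P H.
  by rewrite -h1Dh2 /h1 addrA subrr add0r.
rewrite /h4 h1Dh2 h2E /=; move: (P H *m chi *m P H) => N.
by rewrite !mulNmx opprK /hatC !mulmxA.
Qed.

(** Write Y = y y^T, N = P chi P and C for [hatC H]. All of h_3 cancels against h_4, and N Y (H^-1 -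
    C) + (H^-1 - C) Y N remains, with H^-1 - C = P. *)
Lemma h3Bh4 H chi : spd H -> symmetric_mx chi ->
  h3 y H chi - h4 X y H chi =
  P H *m chi *m P H *m y *m y^T *m P H + P H *m y *m y^T *m P H *m chi *m P H.
Proof.
move=> sH sC; rewrite h4E /h3 /=.
have -> : P H *m y *m y^T *m P H *m chi *m P H =
    P H *m (y *m y^T) *m (P H *m chi *m P H) by rewrite !mulmxA.
have -> : invmx H *m y *m y^T *m invmx H *m chi *m invmx H =
    invmx H *m (y *m y^T) *m (invmx H *m chi *m invmx H) by rewrite !mulmxA.
rewrite -![_ *m y *m y^T]mulmxA.
have TY : (y *m y^T)^T = y *m y^T by rewrite trmx_mul trmxK.
have TG : (invmx H *m chi *m invmx H)^T = invmx H *m chi *m invmx H.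
  by rewrite !trmx_mul (invmx_sym sH) sC mulmxA.
have TN : (P H *m chi *m P H)^T = P H *m chi *m P H.
  by rewrite !trmx_mul (Pmx_sym sH) sC mulmxA.
move: TY TG TN (invmx_sym sH) (hatC_sym sH) (PmxE H).
(* After this generalisation only P = H^-1 - C and the symmetry of the atoms are left, and the
   identity is one of noncommutative polynomials. *)
move: (P H *m chi *m P H) (invmx H *m chi *m invmx H) (y *m y^T).
move: (P H) (invmx H) (hatC H) => Q Hi C N G Y TY TG TN THi TC ->.
rewrite [(_ + _)^T]linearD/= !trmx_mul [(_ - _)^T]linearB/= THi TC TY TG TN.
by mx_expand; mx_linear; ring.
Qed.

(** The curve is positive definite at t but may leave the symmetric matrices, as it does for a
    gradient tested in arbitrary directions. *)
Lemma is_derive_Pmx (F : R -> 'M[R]_n) (t : R) dF : spd (F t) ->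
  is_derive t (1 : R) F dF ->
  is_derive t (1 : R) (fun u : R => P (F u)) (- (P (F t) *m dF *m P (F t))).
Proof.
move=> sF DF; have DI := is_derive_invmx (spd_unitmx sF) DF.
have DXI := is_derive_mulmxr X (is_derive_mulmxl X^T DI).
have DA := is_derive_invmx (spd_unitmx (spd_info sF)) DXI.
have DC := is_derive_mulmx (is_derive_mulmxr X^T
  (is_derive_mulmx (is_derive_mulmxr X DI) DA)) DI.
apply: (is_derive_eq (is_deriveB DI DC)).
by rewrite /Pmx; mx_expand; mx_linear; ring.
Qed.

Lemma is_derive_yPy (F : R -> 'M[R]_n) (t : R) dF : spd (F t) ->
  is_derive t (1 : R) F dF ->
  is_derive t (1 : R) (fun u : R => yPy X y (F u))
    (- (y^T *m P (F t) *m dF *m P (F t) *m y) 0 0).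
Proof.
move=> sF DF.
have D := is_derive_mulmxr y (is_derive_mulmxl y^T (is_derive_Pmx sF DF)).
have /is_derive_mxP/(_ 0 0)/is_derive_eq := D; apply.
by rewrite mulmxN mulNmx oppmxE !mulmxA.
Qed.

Lemma is_derive_expRN (e : R -> R) (t de : R) : is_derive t (1 : R) e de ->
  is_derive t (1 : R) (fun u : R => (expR (e u))^-1) (- de * (expR (e t))^-1).
Proof.
move=> De; have -> : (fun u : R => (expR (e u))^-1) = expR \o (- e).
  by apply/funext => u /=; rewrite -expRN.
have := is_derive1_comp (is_derive_expR ((- e) t)) (is_deriveN De).
by move/is_derive_eq; apply; rewrite -expRN mulrC.
Qed.

(** Both arguments move, so that the same formula serves the Euclidean gradient, with [e] constant,
    and the Riemannian gradient. *)
Lemma is_derive_LRH (e : R -> R) (F : R -> 'M[R]_n) (t de : R) dF :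
  spd (F t) -> is_derive t (1 : R) e de -> is_derive t (1 : R) F dF ->
  is_derive t (1 : R) (fun u : R => LRH X y (e u) (F u))
    ((n%:R - p%:R - yPy X y (F t) / expR (e t)) * de + \tr (P (F t) *m dF)
     - (y^T *m P (F t) *m dF *m P (F t) *m y) 0 0 / expR (e t)).
Proof.
move=> sF De DF; have DI := is_derive_invmx (spd_unitmx sF) DF.
have DXI := is_derive_mulmxr X (is_derive_mulmxl X^T DI).
have D1 := is_derive_mul (is_derive_cst (n%:R - p%:R : R) t (1 : R)) De.
have D2 := is_derive_lndet (spd_det_gt0 sF) DF.
have D3 := is_derive_lndet (spd_det_gt0 (spd_info sF)) DXI.
have D4 := is_derive_mul (is_derive_yPy sF DF) (is_derive_expRN De).
have D := is_deriveD (is_deriveD (is_deriveD D1 D2) D3) D4.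
apply: (is_derive_eq D).
(* The two logarithmic determinants contribute the two terms of P: the second one gives minus the
   trace of [hatC (F t) *m dF], after a cyclic rotation. *)
have -> : \tr (P (F t) *m dF) = \tr (invmx (F t) *m dF) +
    \tr (invmx (info (F t)) *m
         (X^T *m - (invmx (F t) *m dF *m invmx (F t)) *m X)).
  rewrite PmxE mulmxBl mxtraceD mxtraceN; congr (_ + _).
  rewrite mulmxN mulNmx mulmxN mxtraceN; congr (- _).
  have -> : hatC (F t) *m dF =
      invmx (F t) *m X *m (invmx (info (F t)) *m (X^T *m invmx (F t) *m dF)).
    by rewrite /hatC !mulmxA.
  by rewrite mxtrace_mulC !mulmxA.
by rewrite /cst; ring.
Qed.

(** * Differentiability of the objective as a function of H *)

Section Differentiable.
Variable H : 'M[R]_n.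
Hypothesis spdH : spd H.
Local Notation diffH := (fun f : 'M[R]_n -> R => differentiable f H).

Let algH := differentiable_fun_algebra H.

Let d_id : mx_all diffH (fun W => W).
Proof. by move=> i j; exact: differentiable_coord. Qed.

Let d_inv : mx_all diffH (fun W => invmx W).
Proof. exact: differentiable_entries_invmx d_id (spd_unitmx spdH). Qed.

Let d_info : mx_all diffH (fun W => info W).
Proof.
by do ?apply: (mx_allM algH) => //; exact: (mx_all_cst algH).
Qed.

(** [is_euclidean_grad] asks for a full differential, which derivatives along lines do not provide;
    the entrywise closure properties do. *)
Lemma differentiable_yPy : differentiable (yPy X y) H.
Proof.
have dA := differentiable_entries_invmx d_info (spd_unitmx (spd_info spdH)).
have cst k l (B : 'M[R]_(k, l)) := mx_all_cst algH B.
have dP : mx_all diffH P.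
  apply: (mx_allB algH) => //.
  exact: (mx_allM algH (mx_allM algH (mx_allM algH (mx_allM algH d_inv
    (cst _ _ X)) dA) (cst _ _ X^T)) d_inv).
exact: (mx_allM algH (mx_allM algH (cst _ _ y^T) dP) (cst _ _ y) 0 0).
Qed.

Lemma differentiable_lndet m (F : 'M[R]_n -> 'M[R]_m) :
  mx_all diffH F -> spd (F H) -> differentiable (fun W => ln (\det (F W))) H.
Proof.
move=> dF sF; have ddet := mx_all_det algH dF.
have dln : differentiable (@ln R) (\det (F H)).
  by apply/derivable1_diffP; case: (is_derive1_ln (spd_det_gt0 sF)).
exact: (differentiable_comp ddet dln).
Qed.

Lemma differentiable_LRH eta : differentiable (LRH X y eta) H.
Proof.
apply: (fun_algebra_add algH); last first.
  apply: (fun_algebra_mul algH); first exact: differentiable_yPy.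
  exact: (fun_algebra_cst algH).
apply: (fun_algebra_add algH).
  apply: (fun_algebra_add algH); first exact: (fun_algebra_cst algH).
  exact: (differentiable_lndet d_id).
exact: (differentiable_lndet d_info (spd_info spdH)).
Qed.

End Differentiable.

(** Testing against elementary matrices recovers every entry of a gradient, which determines the
    choice of [xget]. *)
Lemma euclidean_gradE (f : 'M[R]_n -> R) H G :
  is_euclidean_grad f H G -> euclidean_grad f H = G.
Proof.
move=> fG; have : is_euclidean_grad f H (euclidean_grad f H).
  by apply: (@xgetPex _ _ [set G | is_euclidean_grad f H G]); exists G.
move=> [_ gE]; case: fG => [_ GE]; apply/matrixP => i j.
have tr_delta (A : 'M[R]_n) : \tr (A^T *m delta_mx i j) = A i j.
  rewrite /mxtrace (bigD1 j)//= big1 ?addr0 => [|k kj]; last first.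
    by rewrite mxE big1// => l _; rewrite !mxE (negbTE kj) andbF mulr0.
  rewrite mxE (bigD1 i)//= big1 ?addr0 => [|k ki].
    by rewrite !mxE !eqxx mulr1.
  by rewrite !mxE (negbTE ki) mulr0.
by rewrite -!tr_delta gE GE.
Qed.

Definition gradyPy (H : 'M[R]_n) : 'M[R]_n := - (P H *m y *m y^T *m P H).

Definition gradLRH (eta : R) (H : 'M[R]_n) : 'M[R]_n :=
  P H + (expR eta)^-1 *: gradyPy H.

(** The prime denotes the derivative in H along [chi]; the sign of - P chi P cancels that of
    [gradyPy]. *)
Definition gradyPy' (H chi : 'M[R]_n) : 'M[R]_n :=
  P H *m chi *m P H *m y *m y^T *m P H + P H *m y *m y^T *m P H *m chi *m P H.

Definition gradLRH' (eta : R) (H chi : 'M[R]_n) : 'M[R]_n :=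
  - (P H *m chi *m P H) + (expR eta)^-1 *: gradyPy' H chi.

Lemma gradyPy_sym H : spd H -> (gradyPy H)^T = gradyPy H.
Proof.
move=> sH; rewrite /gradyPy linearN/=; congr (- _).
by rewrite !trmx_mul trmxK Pmx_sym// !mulmxA.
Qed.

Lemma gradLRH_sym eta H : spd H -> (gradLRH eta H)^T = gradLRH eta H.
Proof. by move=> sH; rewrite linearD linearZ/= Pmx_sym// gradyPy_sym. Qed.

Lemma tr_gradyPy H V :
  \tr (gradyPy H *m V) = - (y^T *m P H *m V *m P H *m y) 0 0.
Proof.
rewrite /gradyPy mulNmx mxtraceN; congr (- _).
have -> : P H *m y *m y^T *m P H *m V = P H *m y *m (y^T *m P H *m V).
  by rewrite !mulmxA.
by rewrite mxtrace_mulC /mxtrace big_ord1 !mulmxA.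
Qed.

Lemma is_euclidean_grad_yPy H : spd H ->
  is_euclidean_grad (yPy X y) H (gradyPy H).
Proof.
move=> sH; have dQ := differentiable_yPy sH; split=> // V.
rewrite gradyPy_sym// tr_gradyPy -deriveE//.
have D : is_derive H V (yPy X y) (- (y^T *m P H *m V *m P H *m y) 0 0).
  apply/is_derive_lineP.
  have := @is_derive_yPy (fun h : R => h *: V + H) 0 V.
  by rewrite scale0r add0r; apply => //; exact: is_derive_affine.
by have [_ ->] := D.
Qed.

Lemma is_euclidean_grad_LRH eta H : spd H ->
  is_euclidean_grad (LRH X y eta) H (gradLRH eta H).
Proof.
move=> sH; have dQ := differentiable_LRH sH eta; split=> // V.
rewrite gradLRH_sym// /gradLRH mulmxDl -scalemxAl mxtraceD mxtraceZ tr_gradyPy.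
rewrite -deriveE//.
have D : is_derive H V (LRH X y eta) (\tr (P H *m V) -
    (y^T *m P H *m V *m P H *m y) 0 0 / expR eta).
  apply/is_derive_lineP.
  have := @is_derive_LRH (cst eta) (fun h : R => h *: V + H) 0 0 V.
  rewrite scale0r add0r mulr0 add0r; apply => //; exact: is_derive_affine.
by have [_ ->] := D; rewrite mulrN mulrC.
Qed.

Lemma is_derive_gradyPy (F : R -> 'M[R]_n) (t : R) dF : spd (F t) ->
  is_derive t (1 : R) F dF ->
  is_derive t (1 : R) (fun u : R => gradyPy (F u)) (gradyPy' (F t) dF).
Proof.
move=> sF DF; have DP := is_derive_Pmx sF DF.
have D := is_deriveN (is_derive_mulmx
  (is_derive_mulmxr y^T (is_derive_mulmxr y DP)) DP).
apply: (is_derive_eq D).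
rewrite /gradyPy'; move: (P (F t)) => Q.
by mx_expand; mx_linear; ring.
Qed.

Lemma is_derive_gradLRH (e : R -> R) (F : R -> 'M[R]_n) (t de : R) dF :
  spd (F t) -> is_derive t (1 : R) e de -> is_derive t (1 : R) F dF ->
  is_derive t (1 : R) (fun u : R => gradLRH (e u) (F u))
    (gradLRH' (e t) (F t) dF - (de / expR (e t)) *: gradyPy (F t)).
Proof.
move=> sF De DF.
have D := is_deriveD (is_derive_Pmx sF DF)
  (is_derive_scale (is_derive_expRN De) (is_derive_gradyPy sF DF)).
apply: (is_derive_eq D).
by rewrite /gradLRH'; mx_linear; ring.
Qed.

Lemma spd_near_line d (H chi : 'M[R]_d) : spd H -> symmetric_mx chi ->
  \forall h \near (0 : R), spd (h *: chi + H).
Proof.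
move=> sH sC.
have d1 : differentiable (fun h : R => h *: chi + H) 0.
  by apply/derivable1_diffP; case: (is_derive_affine H chi 0).
have sH0 : spd (0 *: chi + H) by rewrite scale0r add0r.
have near_spd : \forall h \near (0 : R),
    symmetric_mx (h *: chi + H) -> spd (h *: chi + H).
  exact: (differentiable_continuous d1 (spd_near sH0)).
apply: filterS near_spd => h; apply.
by rewrite /symmetric_mx [LHS]linearD/= [X in X + _]linearZ/= sC sH.1.
Qed.

(** For symmetric [chi] the line through H stays positive definite for small parameters, and
    [euclidean_grad] is identified with [gradLRH] at such matrices. *)
Lemma is_derive_euclidean_grad_LRH eta H chi : spd H -> symmetric_mx chi ->
  is_derive H chi (euclidean_grad (LRH X y eta)) (gradLRH' eta H chi).
Proof.
move=> sH sC; apply/is_derive_lineP.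
apply: (@near_eq_is_derive _ _ _ (fun h : R => gradLRH eta (h *: chi + H))).
  near=> h; apply/esym/euclidean_gradE/is_euclidean_grad_LRH.
  by near: h; exact: spd_near_line.
have := @is_derive_gradLRH (cst eta) (fun h : R => h *: chi + H) 0 0 chi.
rewrite scale0r add0r mul0r scale0r subr0; apply => //; exact: is_derive_affine.
Unshelve. all: by end_near. Qed.

Lemma gradLRH'E eta H chi : spd H -> symmetric_mx chi ->
  gradLRH' eta H chi =
  h1 H chi + h2 X H chi + (expR eta)^-1 *: (h3 y H chi - h4 X y H chi).
Proof. by move=> sH sC; rewrite h1Dh2 h3Bh4. Qed.

(** The four terms are those of - (H^-1 - C) y y^T (H^-1 - C) with C = [hatC H]: here C y = H^-1
    v_1, and also C y = H^-1 X A X^T v_2. *)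
Lemma gradyPyE H : spd H ->
  let Hi := invmx H in let A := invmx (info H) in
  let v1 := X *m A *m X^T *m Hi *m y in let v2 := Hi *m y in
  gradyPy H =
    - (Hi *m y *m y^T *m Hi) + Hi *m y *m v1^T *m Hi + Hi *m v1 *m y^T *m Hi
    - Hi *m X *m A *m X^T *m v2 *m v2^T *m X *m A *m X^T *m Hi.
Proof.
move=> sH /=; rewrite !trmx_mul (invmx_sym sH) (invmx_sym (spd_info sH)) trmxK.
by rewrite /gradyPy /Pmx; mx_expand; mx_linear; ring.
Qed.

(** The Hessian formula sums one derivative for each r, whereas the chain rule yields a single
    derivative along the total direction. *)
Lemma gradLRH'_sum eta H (I : Type) (r : seq I) (S : I -> 'M[R]_n) :
  \sum_(i <- r) gradLRH' eta H (S i) = gradLRH' eta H (\sum_(i <- r) S i).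
Proof.
rewrite /gradLRH' /gradyPy'; move: (P H) => Q.
apply/esym; elim/big_rec2: _ => [|i V W _ <-].
  by rewrite !(mulmx0, mul0mx) oppr0 addr0 scaler0 addr0.
by mx_expand; mx_linear; ring.
Qed.

End ProjectionCalculus.

(** * The Riemannian Hessian of L_R *)

Section Hessian.
Variables (R : realType) (n p K : nat) (M q : 'I_K -> nat).
Variables (X : 'M[R]_(n, p)) (y : 'cV[R]_n).
Variable Z : forall j : 'I_K, 'I_(M j) -> 'M[R]_(n, q j).
Hypothesis rankX : \rank X = p.
Local Notation amb := (ambient R q).
Implicit Types (theta xi : amb).

(** The adjoint of [Zsandwich] for the trace form; it carries the Euclidean gradient in H to the one
    in Psi_j. *)
Definition Zpullback (j : 'I_K) (Q : 'M[R]_n) : 'M[R]_(q j) :=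
  \sum_(l < M j) (Z l)^T *m Q *m Z l.

(** The linear part of the affine map [covH], hence its derivative along [xi] at every point. *)
Definition dcovH xi : 'M[R]_n := \sum_(r < K) Zsandwich Z (xi.2 r).

Lemma Zsandwich_sym j (A : 'M[R]_(q j)) :
  symmetric_mx A -> symmetric_mx (Zsandwich Z A).
Proof.
move=> sA; rewrite /symmetric_mx /Zsandwich linear_sum/=.
by apply: eq_bigr => l _; rewrite !trmx_mul trmxK sA mulmxA.
Qed.

Lemma Zpullback_sym j Q : symmetric_mx Q -> symmetric_mx (Zpullback j Q).
Proof.
move=> sQ; rewrite /symmetric_mx /Zpullback linear_sum/=.
by apply: eq_bigr => l _; rewrite !trmx_mul trmxK sQ mulmxA.
Qed.

Lemma tr_Zpullback j Q (A : 'M[R]_(q j)) :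
  \tr (Zpullback j Q *m A) = \tr (Q *m Zsandwich Z A).
Proof.
rewrite /Zpullback /Zsandwich mulmx_suml mulmx_sumr !linear_sum/=.
apply: eq_bigr => l _.
by rewrite -!mulmxA mxtrace_mulC !mulmxA.
Qed.

Lemma covH_spd theta : manifold theta -> spd (covH Z theta.2).
Proof.
move=> mt; apply: spd_add_psd; first exact: spd1.
apply: psd_sum => j; apply: psd_sum => l; apply: psd_congr.
exact/spd_psd/mt.
Qed.

Lemma covH_line theta xi (t : R) :
  covH Z (theta + t *: xi).2 = t *: dcovH xi + covH Z theta.2.
Proof.
rewrite /covH addrCA; congr (_ + _); rewrite scaler_sumr -big_split/=.
apply: eq_bigr => j _; rewrite /Zsandwich scaler_sumr -big_split/=.
apply: eq_bigr => l _.
by rewrite addrC mulmxDr mulmxDl -scalemxAr -scalemxAl.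
Qed.

Lemma is_derive_covH theta xi :
  is_derive (0 : R) (1 : R) (fun t : R => covH Z (theta + t *: xi).2)
    (dcovH xi).
Proof. by under eq_fun do rewrite covH_line; exact: is_derive_affine. Qed.

Lemma is_derive_eta theta xi :
  is_derive (0 : R) (1 : R) (fun t : R => (theta + t *: xi).1) xi.1.
Proof.
have D := is_derive_mul (is_derive_id (0 : R) (1 : R))
  (is_derive_cst xi.1 (0 : R) (1 : R)).
apply: (is_derive_eq (is_deriveD (is_derive_cst theta.1 (0 : R) (1 : R)) D)).
by rewrite add0r mul1r mulr0 addr0.
Qed.

Definition gradLR theta : amb :=
  (n%:R - p%:R - yPy X y (covH Z theta.2) / expR theta.1,
   fun j => theta.2 j *m Zpullback j (gradLRH X y theta.1 (covH Z theta.2))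
            *m theta.2 j).

Lemma is_riemannian_gradLR theta : manifold theta ->
  is_riemannian_grad (LR X y Z) theta (gradLR theta).
Proof.
move=> mt; have sH := covH_spd mt; split=> [j|xi tx].
  have sG := Zpullback_sym j (gradLRH_sym y rankX theta.1 sH).
  by rewrite /symmetric_mx /= !trmx_mul (mt j).1 sG mulmxA.
have e0 : theta + 0 *: xi = theta by rewrite scale0r addr0.
have sH0 : spd (covH Z (theta + 0 *: xi).2) by rewrite e0.
have D := is_derive_LRH y rankX sH0 (is_derive_eta theta xi)
  (is_derive_covH theta xi).
rewrite (@is_derive_Ddir _ _ _ (LR X y Z) _ _ _ D) e0.
rewrite /metric /= -[RHS]addrA; congr (_ + _).
(* The inverses of Psi_j in the metric cancel the outer factors Psi_j of the gradient block, leaving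
   a pairing that [tr_Zpullback] moves to H. *)
transitivity (\sum_j
    \tr (gradLRH X y theta.1 (covH Z theta.2) *m Zsandwich Z (xi.2 j))).
  apply: eq_bigr => j _; have uj := spd_unitmx (mt j).
  by rewrite -tr_Zpullback /= !mulmxA mulVmx// mul1mx mulmxK.
rewrite -linear_sum/= -mulmx_sumr -/(dcovH xi) /gradLRH mulmxDl -scalemxAl.
by rewrite mxtraceD mxtraceZ tr_gradyPy mulrN mulrC.
Qed.

Lemma mx_all_smooth_covH : mx_all (@smooth R K q) (fun th => covH Z th.2).
Proof.
have algS := smooth_fun_algebra R q.
apply: (mx_allD algS); first exact: (mx_all_cst algS).
apply: (mx_all_sum algS) => j _; apply: (mx_all_sum algS) => l _.
exact: (mx_allM algS (mx_allM algS (mx_all_cst algS _)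
  (@mx_all_smooth_snd R K q j)) (mx_all_cst algS _)).
Qed.

Lemma mx_all_smooth_Pmx :
  mx_all (@smooth R K q) (fun th => Pmx X (covH Z th.2)).
Proof.
have algS := smooth_fun_algebra R q.
have cst k l (B : 'M[R]_(k, l)) := mx_all_cst algS B.
have sI := mx_all_smooth_invmx (fun th mt => spd_unitmx (covH_spd mt))
  mx_all_smooth_covH.
have sA := mx_all_smooth_invmx
  (fun th mt => spd_unitmx (spd_info rankX (covH_spd mt)))
  (mx_allM algS (mx_allM algS (cst _ _ X^T) sI) (cst _ _ X)).
apply: (mx_allB algS) => //.
exact: (mx_allM algS (mx_allM algS (mx_allM algS (mx_allM algS sI
  (cst _ _ X)) sA) (cst _ _ X^T)) sI).
Qed.

(** The axioms of the Levi-Civita connection constrain it on smooth fields only, so the Hessian is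
    accessible once the gradient is such a field. *)
Lemma smooth_field_gradLR : smooth_field gradLR.
Proof.
have algS := smooth_fun_algebra R q; have sP := mx_all_smooth_Pmx.
have cst k l (B : 'M[R]_(k, l)) := mx_all_cst algS B.
have sE : smooth (fun th : amb => (expR th.1)^-1).
  apply: smoothV; last exact/smooth_expR/smooth_fst.
  by move=> th _; rewrite gt_eqF// expR_gt0.
have sQ : smooth (fun th : amb => yPy X y (covH Z th.2)).
  exact: (mx_allM algS (mx_allM algS (cst _ _ y^T) sP) (cst _ _ y) 0 0).
split=> [th mt||j]; first by case: (is_riemannian_gradLR mt).
  apply: (fun_algebra_add algS); first exact: (fun_algebra_cst algS).
  apply: (@smooth_ext _ _ _ (fun th : amb =>
    -1 * (yPy X y (covH Z th.2) * (expR th.1)^-1))).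
    by move=> th _; rewrite mulN1r.
  apply: (fun_algebra_mul algS); first exact: (fun_algebra_cst algS).
  exact: (fun_algebra_mul algS).
have sG : mx_all (@smooth R K q)
    (fun th : amb => gradLRH X y th.1 (covH Z th.2)).
  apply: (mx_allD algS) => //; apply: (mx_allZ algS) => //.
  apply: (mx_allN algS).
  exact: (mx_allM algS (mx_allM algS (mx_allM algS sP (cst _ _ y))
    (cst _ _ y^T)) sP).
have sS := @mx_all_smooth_snd R K q j.
apply: (mx_allM algS (mx_allM algS sS _) sS).
apply: (mx_all_sum algS) => l _.
exact: (mx_allM algS (mx_allM algS (cst _ _ _) sG) (cst _ _ _)).
Qed.

Lemma ZpullbackBZ j Q1 (a : R) Q2 :
  Zpullback j (Q1 - a *: Q2) = Zpullback j Q1 - a *: Zpullback j Q2.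
Proof.
rewrite /Zpullback scaler_sumr -sumrB; apply: eq_bigr => l _.
by rewrite mulmxBr mulmxBl -scalemxAr -scalemxAl.
Qed.

Lemma Dfield_gradLR theta xi : manifold theta -> tangent xi ->
  let H := covH Z theta.2 in let S := dcovH xi in
  Dfield gradLR theta xi =
  (((y^T *m Pmx X H *m S *m Pmx X H *m y) 0 0 + yPy X y H * xi.1) /
     expR theta.1,
   fun j =>
     xi.2 j *m Zpullback j (gradLRH X y theta.1 H) *m theta.2 j
     + theta.2 j *m Zpullback j (gradLRH' X y theta.1 H S
         - (xi.1 / expR theta.1) *: gradyPy X y H) *m theta.2 j
     + theta.2 j *m Zpullback j (gradLRH X y theta.1 H) *m xi.2 j).
Proof.
move=> mt tx H S; have sH := covH_spd mt.
have e0 : theta + 0 *: xi = theta by rewrite scale0r addr0.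
have De := is_derive_eta theta xi; have DH := is_derive_covH theta xi.
have sH0 : spd (covH Z (theta + 0 *: xi).2) by rewrite e0.
apply: DfieldE => [|j].
  have D := is_deriveB (is_derive_cst (n%:R - p%:R : R) (0 : R) (1 : R))
    (is_derive_mul (is_derive_yPy y rankX sH0 DH) (is_derive_expRN De)).
  apply: (is_derive_eq D); rewrite e0 -/H -/S /=; ring.
have DG := is_derive_gradLRH y rankX sH0 De DH.
have DZ : is_derive (0 : R) (1 : R)
    (fun t : R => Zpullback j (gradLRH X y (theta + t *: xi).1
                                 (covH Z (theta + t *: xi).2)))
    (Zpullback j (gradLRH' X y theta.1 H S
         - (xi.1 / expR theta.1) *: gradyPy X y H)).
  apply: is_derive_sum_seq => l.
  by have := is_derive_mulmxr (Z l) (is_derive_mulmxl (Z l)^T DG); rewrite e0.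
have DP : is_derive (0 : R) (1 : R) (fun t : R => (theta + t *: xi).2 j)
    (xi.2 j).
  rewrite (_ : (fun _ => _) = (fun t : R => t *: xi.2 j + theta.2 j)).
    exact: is_derive_affine.
  by apply/funext => t; exact: addrC.
have D := is_derive_mulmx (is_derive_mulmx DP DZ) DP.
by apply: (is_derive_eq D); rewrite e0 mulmxDl.
Qed.

(** With T = Psi_j, the product rule yields x G T + T G x with coefficient 1 and the connection
    removes half of it; this is the origin of the + 1/2 in the Hessian. *)
Lemma hessian_block_identity d (T x G D Q : 'M[R]_d) (a : R) :
  T \in unitmx ->
  x *m G *m T + T *m (D - a *: Q) *m T + T *m G *m x
  - 2^-1 *: (x *m invmx T *m (T *m G *m T) + T *m G *m T *m invmx T *m x) =
  T *m (D - a *: Q) *m T + 2^-1 *: (x *m G *m T + T *m G *m x).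
Proof.
move=> uT; rewrite mulmxK//.
have -> : x *m invmx T *m (T *m G *m T) = x *m G *m T.
  by rewrite !mulmxA mulmxKV.
by mx_linear; field.
Qed.

Lemma smooth_field_ext (U V : amb -> amb) :
  (forall th, manifold th -> U th = V th) -> smooth_field U -> smooth_field V.
Proof.
move=> UV [tU sU1 sU2]; split=> [th mt||j a b].
- by rewrite -UV//; exact: tU.
- by apply: smooth_ext sU1 => th /UV ->.
- by apply: smooth_ext (sU2 j a b) => th /UV ->.
Qed.

Lemma riemannian_hess_LR theta xi : manifold theta -> tangent xi ->
  tangent (riemannian_hess (LR X y Z) theta xi) /\
  riemannian_hess (LR X y Z) theta xi =
  Dfield gradLR theta xi + christoffel theta xi (gradLR theta).
Proof.
move=> mt tx.
have gE th : manifold th -> gradLR th = riemannian_grad (LR X y Z) th.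
  by move=> mth; apply/esym/riemannian_gradE => //; exact: is_riemannian_gradLR.
have sg := smooth_field_ext gE smooth_field_gradLR.
rewrite /riemannian_hess levi_civitaE//; split.
  have [+ _ _] := nabla_smooth_field (smooth_field_cst tx) sg.
  exact.
rewrite /affine_invariant_connection -gE//; congr (_ + _).
by apply: Dfield_ext => // th /gE.
Qed.

End Hessian.

Unset Implicit Arguments.

Theorem theorem3 (R : realType) (n p K : nat) (M q : 'I_K -> nat)
    (X : 'M[R]_(n, p)) (y : 'cV[R]_n)
    (Z : forall j : 'I_K, 'I_(M j) -> 'M[R]_(n, q j))
    (n_gt0 : (0 < n)%N) (p_gt0 : (0 < p)%N) (K_gt0 : (0 < K)%N)
    (M_gt0 : forall j, (0 < M j)%N) (q_gt0 : forall j, (0 < q j)%N)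
    (X_full_col_rank : \rank X = p)
    (theta : ambient R q) (theta_in : manifold theta)
    (xi : ambient R q) (xi_tangent : tangent xi) :
  let eta := theta.1 in
  let Psi := theta.2 in
  let H := covH Z Psi in
  let Hi := invmx H in
  let A := invmx (X^T *m Hi *m X) in
  let gradL := euclidean_grad (LRH X y eta) in
  let gradQ := euclidean_grad (yPy X y) in
  let S := fun r : 'I_K => \sum_(l < M r) Z r l *m xi.2 r *m (Z r l)^T in
  let v1 := X *m A *m X^T *m Hi *m y in
  let v2 := Hi *m y in
  let zeta_eta : R :=
    (expR eta)^-1 *
    (xi.1 * (y^T *m Pmx X H *m y) 0 0
     - \sum_(j < K) (y^T *m (h1 H (S j) + h2 X H (S j)) *m y) 0 0) in
  let zeta_Psi : blocks R q := fun j =>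
    Psi j *m
      (\sum_(r < K) \sum_(l < M j) (Z j l)^T *m 'D_(S r) gradL H *m Z j l
       - (xi.1 / expR eta) *: \sum_(l < M j) (Z j l)^T *m gradQ H *m Z j l)
      *m Psi j
    + 2^-1 *:
      (xi.2 j *m (\sum_(l < M j) (Z j l)^T *m gradL H *m Z j l) *m Psi j
       + Psi j *m (\sum_(l < M j) (Z j l)^T *m gradL H *m Z j l) *m xi.2 j) in
  let zeta : ambient R q := (zeta_eta, zeta_Psi) in
  [/\ tangent zeta /\ riemannian_hess (LR X y Z) theta xi = zeta,
      forall chi : 'M[R]_n, symmetric_mx chi ->
        is_derive H chi gradL
          (h1 H chi + h2 X H chi
           + (expR eta)^-1 *: (h3 y H chi - h4 X y H chi)),
      gradL H = Pmx X H + (expR eta)^-1 *: gradQ H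
    & gradQ H =
        - (Hi *m y *m y^T *m Hi) + Hi *m y *m v1^T *m Hi
        + Hi *m v1 *m y^T *m Hi
        - Hi *m X *m A *m X^T *m v2 *m v2^T *m X *m A *m X^T *m Hi].
Proof.
move=> eta Psi H Hi A gradL gradQ S v1 v2 zeta_eta zeta_Psi zeta.
have sH : spd H by exact: covH_spd.
have gLE : gradL H = gradLRH X y eta H.
  exact/euclidean_gradE/is_euclidean_grad_LRH.
have gQE : gradQ H = gradyPy X y H.
  exact/euclidean_gradE/is_euclidean_grad_yPy.
have dgL chi : symmetric_mx chi ->
    is_derive H chi gradL (gradLRH' X y eta H chi).
  exact: is_derive_euclidean_grad_LRH.
have sS r : symmetric_mx (S r) by exact: (Zsandwich_sym Z (xi_tangent r)).
have [th hE] := riemannian_hess_LR y Z X_full_col_rank theta_in xi_tangent.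
have zetaE : riemannian_hess (LR X y Z) theta xi = zeta.
  rewrite hE Dfield_gradLR//; apply: ambient_eq => [|j].
    rewrite /= addr0 /zeta_eta.
    (* Since h_1 + h_2 is - P S_j P, the sum over j collapses to one term along [dcovH Z xi]. *)
    have -> : \sum_(j < K) (y^T *m (h1 H (S j) + h2 X H (S j)) *m y) 0 0 =
        - (y^T *m Pmx X H *m dcovH Z xi *m Pmx X H *m y) 0 0.
      rewrite /dcovH mulmx_sumr 2!mulmx_suml summxE -sumrN.
      apply: eq_bigr => j _.
      by rewrite h1Dh2 mulmxN mulNmx oppmxE !mulmxA.
    by rewrite opprK mulrC addrC [xi.1 * _]mulrC.
  rewrite /= /zeta_Psi -/H -/eta -/Psi gLE gQE.
  (* Each S_r is symmetric, so its directional derivative is given by [dgL]; exchanging the sums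
     merges them into one pullback. *)
  have -> : \sum_(r < K) \sum_(l < M j) (Z j l)^T *m 'D_(S r) gradL H *m Z j l =
      Zpullback Z j (gradLRH' X y eta H (dcovH Z xi)).
    rewrite /dcovH -gradLRH'_sum /Zpullback exchange_big/=.
    apply: eq_bigr => l _; rewrite mulmx_sumr mulmx_suml.
    by apply: eq_bigr => r _; have [_ ->] := dgL _ (sS r).
  have uj : theta.2 j \in unitmx by exact: spd_unitmx (theta_in j).
  apply: etrans (hessian_block_identity (xi.2 j)
    (Zpullback Z j (gradLRH X y eta H))
    (Zpullback Z j (gradLRH' X y eta H (dcovH Z xi)))
    (Zpullback Z j (gradyPy X y H)) (xi.1 / expR eta) uj).
  by rewrite -ZpullbackBZ.
split=> //.
- by rewrite -zetaE.
- by move=> chi sC; rewrite -gradLRH'E//; exact: dgL.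
- by rewrite gLE gQE.
- by rewrite gQE; exact: gradyPyE.
Qed.
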